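(* For all sufficiently large $\omega$, the even function $$\breve V_\omega:=-\omega\,\tilde\chi_\omega\ast\big(\tilde\chi_\omega\,\alpha_\omega^{-m/2}\bar K\big)$$ satisfies $\breve R_\omega=-\omega^{-1}\tilde\chi_\omega\ast(\delta_\omega\beta_\omega\breve V_\omega)$ as well as $$\breve V_\omega(\tilde x)=-\tfrac12\,\omega\,\alpha_\omega^{-m/2}\big(\bar Y'(\tilde x-\xi_\omega)-\bar Y'(\xi_\omega)\big)\qquad\text{for }0\le\tilde x\le2\xi_\omega$$ and $\breve V_\omega(\tilde x)=0$ for $\tilde x\ge2\xi_\omega$. Moreover, we have $$\delta_\omega\big\|\omega^{-1}\tilde V_\omega-\omega^{-1}\breve V_\omega\big\|_1+\big\|\omega^{-1}\tilde V_\omega-\omega^{-1}\breve V_\omega\big\|_\infty+\big\|\omega^{-1}\tilde V_\omega'-\omega^{-1}\breve V_\omega'\big\|_1\le C\delta_\omega^{\min\{k,m\}}$$ for some constant $C$ independent of $\omega$, where $\tilde V_\omega=-\tilde\chi_\omega\ast\big(\delta_\omega^{m/2+1}\alpha_\omega^{m/2+1}\Phi'(\tilde R_\omega)\big)$.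
   Context: Standing assumption on the potential: there are real $m>0$, $k>0$ with $m\ne k$, $\min\{k,m\}>1$, and a constant $C_\Phi$ such that $\Phi$ is a strictly convex $C^3$-function on $(-1,0]$ with a global minimum at $r=0$, $\Phi(0)=\Phi'(0)=0$, $\Phi''(0)>0$, and for all $r\in(-1,-1/4)$ $$|m+2+\Phi'''(r)(1+r)^{m+3}|\le C_\Phi(1+r)^k,\quad |1+(m+1)\Phi'(r)(1+r)^{m+1}|+|-1+\Phi''(r)(1+r)^{m+2}|\le C_\Phi(1+r)^k.$$ For $\omega>0$ let $\delta_\omega=\omega^{-2/m}$. Let $\bar Y:\mathbb R\to(0,\infty)$ be the unique solution of $\bar Y''=\frac{2}{m+1}\bar Y^{-(m+1)}$, $\bar Y(0)=1$, $\bar Y'(0)=0$. For large $\omega$, $\xi_\omega$ is the unique number $\ge1$ with $\delta_\omega^{m/(m+2)}\big(\xi_\omega\bar Y'(\xi_\omega)+\bar Y(\xi_\omega)\big)=(2\xi_\omega)^{2/(m+2)}$, and $\alpha_\omega=(2\delta_\omega\xi_\omega)^{-2/(m+2)}$, $\beta_\omega=\alpha_\omega^{(m+2)/2}$, so $\xi_\omega=1/(2\delta_\omega\beta_\omega)$. $\tilde\chi_\omega$ is the indicator function of $[-\xi_\omega,\xi_\omega]$; $\ast$ is convolution on $\mathbb R$; $\|\cdot\|_p$ is the $L^p(\mathbb R)$-norm. Put $\bar K=-\frac{1}{(m+1)\bar Y^{m+1}}$, $\breve R_\omega=\tilde\chi_\omega\ast\tilde\chi_\omega\ast(\tilde\chi_\omega\delta_\omega\alpha_\omega\bar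 K)$, $\|\tilde U\|_{*,\omega}=|\tilde U(0)|+\|\tilde U''\|_1+\delta_\omega^2\|\tilde U\|_1+\delta_\omega\|\tilde U\|_\infty$. High-energy distance profiles: there is a constant $D$ depending only on $\Phi$ such that for all sufficiently large $\omega$ the equation $\tilde R=\tilde\chi_\omega\ast\tilde\chi_\omega\ast\big(\delta_\omega^{m+2}\alpha_\omega^{m+2}\Phi'(\tilde R)\big)$ has a unique even solution $\tilde R_\omega$ with $\|\tilde R_\omega-\breve R_\omega\|_{*,\omega}\le D\delta_\omega^{\min\{k,m\}+1}$; it has values in $(-1,0]$. $\tilde R_\omega$ denotes this solution. *)

(* Defs.v *)
(* MathComp-Analysis. *)
From HB Require Import structures.
From mathcomp Require Import all_boot all_order all_algebra.
From mathcomp Require Import all_classical all_reals all_analysis.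

Set Implicit Arguments.
Unset Strict Implicit.
Unset Printing Implicit Defensive.

Import Order.TTheory GRing.Theory Num.Theory.
Import numFieldNormedType.Exports.

Local Open Scope classical_set_scope.
Local Open Scope ring_scope.

(* Derivative relative to A: at a point of A that belongs to the boundary of A
   it is one-sided, at an interior point it is the usual derivative. *)
Definition difference_quotient (R : realType) (f : R -> R) (x y : R) : R :=
  (f y - f x) / (y - x).

Definition derivable_within (R : realType) (A : set R) (f : R -> R) (x : R) :=
  cvg (difference_quotient f x y @[y --> within A x^']).

Definition derive_within (R : realType) (A : set R) (f : R -> R) (x : R) : R :=
  lim (difference_quotient f x y @[y --> within A x^']).

Definition deriven_within (R : realType) (A : set R) (n : nat) (f : R -> R) :
  R -> R := iter n (derive_within A) f.

Definition Cn_on (R : realType) (n : nat) (A : set R) (f : R -> R) :=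
  (forall i, (i < n)%N ->
     forall x, A x -> derivable_within A (deriven_within A i f) x) /\
  {within A, continuous (deriven_within A n f)}.

Definition strictly_convex_on (R : realType) (A : set R) (f : R -> R) :=
  forall x y t : R, A x -> A y -> x != y -> 0 < t < 1 ->
    f (t * x + (1 - t) * y) < t * f x + (1 - t) * f y.

Definition dom_Phi (R : realType) : set R := `]-1, 0]%classic.

Definition dPhi (R : realType) (n : nat) (Phi : R -> R) : R -> R :=
  deriven_within (@dom_Phi R) n Phi.

(* Only the values of Phi on ]-1, 0] matter. *)
Record potential (R : realType) (m k CPhi : R) (Phi : R -> R) : Prop :=
  Potential {
    pot_m_gt0 : 0 < m ;
    pot_k_gt0 : 0 < k ;
    pot_m_neq_k : m != k ;
    pot_min_gt1 : 1 < Num.min k m ;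
    pot_convex : strictly_convex_on (@dom_Phi R) Phi ;
    pot_C3 : Cn_on 3 (@dom_Phi R) Phi ;
    pot_min : forall r, dom_Phi r -> Phi 0 <= Phi r ;
    pot_0 : Phi 0 = 0 ;
    pot_d0 : dPhi 1 Phi 0 = 0 ;
    pot_dd0 : 0 < dPhi 2 Phi 0 ;
    pot_asymp3 : forall r, -1 < r < - 4^-1 ->
      `|m + 2 + dPhi 3 Phi r * (1 + r) `^ (m + 3)| <= CPhi * (1 + r) `^ k ;
    pot_asymp12 : forall r, -1 < r < - 4^-1 ->
      `|1 + (m + 1) * dPhi 1 Phi r * (1 + r) `^ (m + 1)|
        + `|- 1 + dPhi 2 Phi r * (1 + r) `^ (m + 2)|
      <= CPhi * (1 + r) `^ k }.

(* Uniqueness is not part of is_Ybar, is_xi and is_distance_profile: a theorem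
   quantifies over all objects with these properties, hence covers the unique
   one whenever there is only one. *)
Definition is_Ybar (R : realType) (m : R) (Y : R -> R) :=
  [/\ forall x, 0 < Y x,
      forall x, derivable Y x 1,
      forall x, derivable (derive1 Y) x 1,
      forall x, derive1 (derive1 Y) x = 2 / (m + 1) * Y x `^ (- (m + 1)) &
      Y 0 = 1 /\ derive1 Y 0 = 0].

Definition Kbar (R : realType) (m : R) (Y : R -> R) (x : R) : R :=
  - ((m + 1) * Y x `^ (m + 1))^-1.

Definition delta_omega (R : realType) (m omega : R) : R := omega `^ (- (2 / m)).

Definition is_xi (R : realType) (m : R) (Y : R -> R) (omega xi : R) :=
  1 <= xi /\
  delta_omega m omega `^ (m / (m + 2)) * (xi * derive1 Y xi + Y xi)
    = (2 * xi) `^ (2 / (m + 2)).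

Definition alpha_omega (R : realType) (m omega xi : R) : R :=
  (2 * delta_omega m omega * xi) `^ (- (2 / (m + 2))).

Definition beta_omega (R : realType) (m omega xi : R) : R :=
  alpha_omega m omega xi `^ ((m + 2) / 2).

Definition chi_omega (R : realType) (xi : R) : R -> R :=
  \1_(`[- xi, xi]%classic).

Definition convolution (R : realType) (f g : R -> R) (x : R) : R :=
  \int[@lebesgue_measure R]_y (f (x - y) * g y).

Definition Lpnorm (R : realType) (p : \bar R) (f : R -> R) : \bar R :=
  Lnorm (@lebesgue_measure R) p (EFin \o f).

(* Derivatives inside norms, here and for the velocity profiles, are taken
   pointwise.  Each function to which this is applied is an iterated convolution
   with chi_omega, or the derivative of one: it is absolutely continuous on
   compact sets and differentiable off a finite set, so that its pointwise
   derivative represents its weak derivative. *)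
Definition star_norm (R : realType) (m omega : R) (U : R -> R) : \bar R :=
  (`|U 0|%:E + Lpnorm 1 (derive1 (derive1 U))
   + (delta_omega m omega ^+ 2)%:E * Lpnorm 1 U
   + (delta_omega m omega)%:E * Lpnorm +oo U)%E.

Definition Rbreve (R : realType) (m : R) (Y : R -> R) (omega xi : R) : R -> R :=
  convolution (chi_omega xi) (convolution (chi_omega xi)
    (fun x => chi_omega xi x * delta_omega m omega * alpha_omega m omega xi
              * Kbar m Y x)).

Definition Vbreve (R : realType) (m : R) (Y : R -> R) (omega xi : R) (x : R) :
  R :=
  - omega * convolution (chi_omega xi)
    (fun y => chi_omega xi y * alpha_omega m omega xi `^ (- (m / 2))
              * Kbar m Y y) x.

(* Local integrability ensures that the convolutions in the equation are
   genuine Lebesgue integrals. *)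
Definition distance_profile_eq (R : realType) (m : R) (Phi : R -> R)
    (omega xi : R) (Rt : R -> R) :=
  locally_integrable [set: R] (dPhi 1 Phi \o Rt) /\
  Rt = convolution (chi_omega xi) (convolution (chi_omega xi)
    (fun x => delta_omega m omega `^ (m + 2)
              * alpha_omega m omega xi `^ (m + 2)
              * dPhi 1 Phi (Rt x))).

Definition is_distance_profile (R : realType) (m k : R) (Phi Y : R -> R) (D : R)
    (omega xi : R) (Rt : R -> R) :=
  [/\ forall x, -1 < Rt x <= 0,
      forall x, Rt (- x) = Rt x,
      distance_profile_eq m Phi omega xi Rt &
      (star_norm m omega (fun x => (Rt x - Rbreve m Y omega xi x)%R)
         <= (D * delta_omega m omega `^ (Num.min k m + 1))%:E)%E].

Definition Vtilde (R : realType) (m : R) (Phi : R -> R) (omega xi : R)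
    (Rt : R -> R) (x : R) : R :=
  - convolution (chi_omega xi)
    (fun y => delta_omega m omega `^ (m / 2 + 1)
              * alpha_omega m omega xi `^ (m / 2 + 1)
              * dPhi 1 Phi (Rt y)) x.

(* Main.v *)
Require Import Defs.
From HB Require Import structures.
From mathcomp Require Import all_boot all_order all_algebra.
From mathcomp Require Import all_classical all_reals all_analysis.
From mathcomp Require Import measurable_realfun ess_sup_inf ring lra.

Set Implicit Arguments.
Unset Strict Implicit.
Unset Printing Implicit Defensive.

Import Order.TTheory GRing.Theory Num.Theory.
Import numFieldNormedType.Exports.

Local Open Scope classical_set_scope.
Local Open Scope ring_scope.

(* All profiles are written through the averaging operator
   [T g = chi_omega xi * g], [T g x] being the integral of [g] over
   [[x - xi, x + xi]].  With [g] the rescaled force along [Rt] and [gb] its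
   approximation, [Rt = T (T g)], [Rbreve = T (T gb)], and since
   [1 / (delta * beta) = 2 * xi] both velocity profiles, divided by [omega],
   are [- 2 * xi] times [T g] and [T gb].  As [xi] is of order [1 / delta],
   the estimate reduces to [|h|_1 <= C * delta ^ (min {k, m} + 1)] for
   [h = g - gb].
   The star norm only controls the second difference
   [h (x + 2 xi) - 2 h x + h (x - 2 xi)] of [h], which is [(Rt - Rbreve)''].
   Outside [[- xi, xi]] however [gb] vanishes, [Rbreve >= - theta > - 1] there
   (about half its value at the centre), so [Phi'] is used only in a range where
   [|Phi' r| <= C |r|], and [g] is of order [delta ^ (m + 2) * |Rt|].  Inside
   [[- xi, xi]] the points [x +- 2 xi] lie outside, and [h x] is recovered from
   the second difference. *)

(** * Translation invariance and averages over a moving window *)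

(** The push-forward of Lebesgue measure under a translation gives half-open intervals their length,
    so uniqueness of Lebesgue measure identifies the two. *)
Lemma ge0_integral_shift (R : realType) (a : R) (f : R -> \bar R) :
  measurable_fun [set: R] f -> (forall x, 0 <= f x)%E ->
  (\int[@lebesgue_measure R]_x f (x + a)%R = \int[@lebesgue_measure R]_x f x)%E.
Proof.
move=> mf f0.
have mT : measurable_fun [set: measurableTypeR R]
    ((fun x : R => x + a) : measurableTypeR R -> measurableTypeR R).
  exact: measurable_funD.
have E A : measurable A ->
    pushforward (@lebesgue_measure R)
      ((fun x : R => x + a) : measurableTypeR R -> measurableTypeR R) A =
    lebesgue_measure A.
  move=> mA; apply/esym/lebesgue_measure_unique => //= _ [[b c]] _ <-.
  rewrite /pushforward.
  have -> : (fun x : R => x + a) @^-1` `]b, c] = `]b - a, c - a]%classic.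
    by apply/seteqP; split => x /=; rewrite !in_itv /= => /andP[? ?]; apply/andP; split; lra.
  rewrite !lebesgue_measure_itv/= !lte_fin -!EFinB; congr (if _ then _%:E else _).
    by rewrite ltrD2r.
  by lra.
transitivity (\int[pushforward (@lebesgue_measure R)
    ((fun x : R => (x + a)%R) : measurableTypeR R -> measurableTypeR R)]_x f x)%E.
  by rewrite ge0_integral_pushforward//= preimage_setT.
by apply: eq_measure_integral => A mA _; exact: E.
Qed.

Lemma chi_omegaBE (R : realType) (xi x y : R) :
  chi_omega xi (x - y) = \1_`[x - xi, x + xi]%classic y.
Proof.
rewrite /chi_omega !indicE; congr (_ %:R); congr nat_of_bool.
by apply/idP/idP; rewrite !inE /= !in_itv /= => /andP[? ?]; apply/andP; split; lra.
Qed.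

Lemma chi_omegaBC (R : realType) (xi x y : R) :
  chi_omega xi (x - y) = chi_omega xi (y - x).
Proof.
rewrite /chi_omega !indicE; congr (_ %:R); congr nat_of_bool.
by apply/idP/idP; rewrite !inE /= !in_itv /= => /andP[? ?]; apply/andP; split; lra.
Qed.

Lemma convolution_chiE (R : realType) (xi : R) (g : R -> R) (x : R) :
  convolution (chi_omega xi) g x =
  \int[@lebesgue_measure R]_(y in `[x - xi, x + xi]) g y.
Proof.
rewrite Rintegral_mkcond; apply: eq_Rintegral => y _.
by rewrite chi_omegaBE patchE indicE; case: ifP => _; rewrite ?mul1r ?mul0r.
Qed.

(** The averages integrate over segments only. This form covers both continuous functions and the
    truncated kernel with its jumps, and it still yields measurability on the whole line. *)
Definition segment_integrable (R : realType) (g : R -> R) :=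
  forall a b, (@lebesgue_measure R).-integrable `[a, b] (EFin \o g).

Section ConvolutionChi.
Variable R : realType.
Notation mu := (@lebesgue_measure R).
Implicit Types (g h : R -> R) (xi x : R).

Lemma continuous_segment_integrable g : continuous g -> segment_integrable g.
Proof.
move=> cg a b; apply: continuous_compact_integrable; first exact: segment_compact.
exact: continuous_subspaceT.
Qed.

Lemma locally_integrable_segment_integrable g :
  locally_integrable [set: R] g -> segment_integrable g.
Proof.
move=> [mg _ ig] a b; apply/integrableP; split.
  by apply/measurable_EFinP; exact: measurable_funTS.
by apply: ig => //; exact: segment_compact.
Qed.

Lemma segment_integrable_measurable g :
  segment_integrable g -> measurable_fun [set: R] g.
Proof.
move=> ig.
have -> : [set: R] = \bigcup_n `[- n%:R, n%:R]%classic.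
  apply/esym; rewrite -subTset => x _.
  exists (Num.truncn `|x|).+1 => //=; rewrite in_itv/= -ler_norml.
  by rewrite ltW// truncnS_gt.
apply/measurable_fun_bigcup => // n.
by have /measurable_int/measurable_EFinP := ig (- n%:R) n%:R.
Qed.

(** A common left endpoint [a] writes the average as a difference of two values of one primitive,
    from which continuity and differentiability in [x] are read off. *)
Lemma convolution_chi_primitive g xi a x : segment_integrable g ->
  0 <= xi -> a <= x - xi ->
  convolution (chi_omega xi) g x =
  \int[mu]_(y in `[a, x + xi]) g y - \int[mu]_(y in `[a, x - xi]) g y.
Proof.
move=> ig xi0 ax; rewrite convolution_chiE Rintegral_itvB; last 3 first.
- exact: ig.
- by rewrite bnd_simp.
- by rewrite bnd_simp; lra.
rewrite Rintegral_itv_obnd_cbnd//.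
by apply: integrableS (ig (x - xi) (x + xi)) => //; exact: subset_itv_oc_cc.
Qed.

Lemma primitive_continuous g a x : segment_integrable g -> a < x ->
  {for x, continuous (fun x => \int[mu]_(y in `[a, x]) g y)}.
Proof.
move=> ig ax.
have ax1 : a <= x + 1 by lra.
have := parameterized_integral_continuous ax1 (ig a (x + 1)).
have ax1' : a < x + 1 by lra.
move=> /(continuous_within_itvP _ ax1')[+ _ _]; apply.
by rewrite in_itv/= ax ltrDl ltr01.
Qed.

Lemma continuous_shift_at (f : R -> R) (c x : R) :
  {for x + c, continuous f} -> {for x, continuous (fun y => f (y + c))}.
Proof.
move=> cf; apply: (@continuous_comp _ _ _ (fun y : R => y + c) f) => //.
by apply: continuousD => //; exact: cst_continuous.
Qed.

Lemma convolution_chi_near g xi x : segment_integrable g -> 0 <= xi ->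
  \forall y \near x, convolution (chi_omega xi) g y =
  \int[mu]_(t in `[x - xi - 1, y + xi]) g t
  - \int[mu]_(t in `[x - xi - 1, y - xi]) g t.
Proof.
(* The base point [x - xi - 1] lies one unit left of the window at [x], so it serves every
   [y > x - 1]. *)
move=> ig xi0; near=> y; apply: convolution_chi_primitive => //.
suff : x - 1 < y by lra.
by near: y; apply: lt_nbhsr; lra.
Unshelve. all: by end_near. Qed.

Lemma convolution_chi_continuous g xi : segment_integrable g -> 0 <= xi ->
  continuous (convolution (chi_omega xi) g).
Proof.
move=> ig xi0 x; rewrite /continuous_at.
have near_eq := convolution_chi_near x ig xi0.
rewrite (nbhs_singleton near_eq).
apply: cvg_trans.
  by apply: near_eq_cvg; apply: filterS near_eq => y ->.
apply: cvgB.
  apply: (@continuous_shift_at (fun y => \int[mu]_(t in `[x - xi - 1, y]) g t)).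
  by apply: primitive_continuous => //; lra.
apply: (@continuous_shift_at (fun y => \int[mu]_(t in `[x - xi - 1, y]) g t)).
by apply: primitive_continuous => //; lra.
Qed.

Lemma is_derive_shift (f : R -> R) (c x d : R) :
  is_derive (x + c) 1 f d -> is_derive x 1 (fun y => f (y + c)) d.
Proof.
move=> df.
have dc : is_derive x (1 : R) (fun y : R => y + c) 1.
  by apply: is_derive_eq; rewrite addr0.
by have := @is_derive1_comp _ f (fun y => y + c) x _ _ df dc; rewrite mulr1.
Qed.

(** Continuity is required at the two window endpoints only: the truncated kernel jumps at [- xi]
    and [xi], and the derivative is needed at all points whose window does not end there. *)
Lemma is_derive_convolution_chi g xi x : segment_integrable g -> 0 <= xi ->
  {for x + xi, continuous g} -> {for x - xi, continuous g} ->
  is_derive x 1 (convolution (chi_omega xi) g) (g (x + xi) - g (x - xi)).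
Proof.
move=> ig xi0 cp cm.
have near_eq := convolution_chi_near x ig xi0.
pose P y := \int[mu]_(t in `[x - xi - 1, y]) g t.
have dP z : x - xi - 1 < z -> {for z, continuous g} -> is_derive z 1 P (g z).
  move=> xz cz.
  have zz1 : z < z + 1 by lra.
  have [dz ez] := continuous_FTC1_closed zz1 (ig _ _) xz cz.
  by apply: DeriveDef; rewrite -?ez ?derive1E.
apply: (@near_eq_is_derive _ _ _ (fun y => P (y + xi) - P (y - xi))) => //.
- by apply: filterS near_eq => y <-.
- apply: is_deriveB.
    by apply: is_derive_shift; apply: dP => //; lra.
  by apply: is_derive_shift; apply: dP => //; lra.
Qed.

Lemma convolution_chiZ g xi c x : segment_integrable g ->
  convolution (chi_omega xi) (fun y => c * g y) x =
  c * convolution (chi_omega xi) g x.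
Proof. by move=> ig; rewrite !convolution_chiE RintegralZl. Qed.

Lemma convolution_chiB g h xi x : segment_integrable g -> segment_integrable h ->
  convolution (chi_omega xi) (fun y => g y - h y) x =
  convolution (chi_omega xi) g x - convolution (chi_omega xi) h x.
Proof. by move=> ig ih; rewrite !convolution_chiE RintegralB. Qed.

Lemma segment_integrableZ g c : segment_integrable g ->
  segment_integrable (fun y => c * g y).
Proof.
move=> ig a b; suff : mu.-integrable `[a, b]
  (fun x => c%:E * (EFin \o g) x)%E by [].
by apply: integrableZl.
Qed.

Lemma segment_integrableB g h : segment_integrable g -> segment_integrable h ->
  segment_integrable (fun y => g y - h y).
Proof.
move=> ig ih a b; suff : mu.-integrable `[a, b]
  ((EFin \o g) \- (EFin \o h))%E by [].
by apply: integrableB.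
Qed.

Lemma convolution_chi_le_segment g xi x : segment_integrable g ->
  (`|convolution (chi_omega xi) g x|%:E <=
   \int[mu]_(y in `[(x - xi)%R, (x + xi)%R]) `|g y|%:E)%E.
Proof.
move=> ig; rewrite convolution_chiE EFin_normr_Rintegral//.
by apply: le_abse_integral => //; have /integrableP[] := ig (x - xi) (x + xi).
Qed.

Lemma convolution_chi_le_norm1 g xi x : segment_integrable g ->
  (`|convolution (chi_omega xi) g x|%:E <= \int[mu]_y `|g y|%:E)%E.
Proof.
move=> ig; apply: le_trans (convolution_chi_le_segment _ _ ig) _.
apply: ge0_subset_integral => //.
by do 2 apply: measurableT_comp => //; exact: segment_integrable_measurable.
Qed.

(** Young's inequality for the indicator, by Tonelli: for fixed [y] the integral of
    [chi_omega xi (x - y)] over [x] is [2 * xi]. *)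
Lemma convolution_chi_norm1 g xi : segment_integrable g -> 0 <= xi ->
  (\int[mu]_x `|convolution (chi_omega xi) g x|%:E <=
   (2 * xi)%:E * \int[mu]_y `|g y|%:E)%E.
Proof.
move=> ig xi0.
have mg := segment_integrable_measurable ig.
have mchi : measurable_fun [set: R] (chi_omega xi) by exact: measurable_indic.
pose F (z : R * R) : \bar R := (chi_omega xi (z.1 - z.2) * `|g z.2|)%:E.
have F0 z : (0 <= F z)%E.
  by rewrite lee_fin mulr_ge0// /chi_omega indicE ler0n.
have mF : measurable_fun [set: R * R] F.
  apply/measurable_EFinP/measurable_funM.
    apply: (measurableT_comp mchi).
    by apply: measurable_funB; [exact: measurable_fst|exact: measurable_snd].
  by apply: measurableT_comp => //; apply: (measurableT_comp mg); exact: measurable_snd.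
apply: (@le_trans _ _ (\int[mu]_x \int[mu]_y F (x, y))%E).
  apply: ge0_le_integral => //.
  - by apply/measurable_EFinP; apply: measurableT_comp => //;
      apply: continuous_measurable_fun; exact: convolution_chi_continuous.
  - exact: (@measurable_fun_fubini_tonelli_F _ _ _ _ _ mu F mF F0).
  - move=> x _; apply: le_trans (convolution_chi_le_segment _ _ ig) _.
    rewrite integral_mkcond le_eqVlt; apply/orP; left; apply/eqP.
    apply: eq_integral => y _.
    by rewrite /F /= chi_omegaBE patchE indicE; case: ifP => _; rewrite ?mul1r ?mul0r.
rewrite (@fubini_tonelli _ _ _ _ _ mu mu F mF F0).
rewrite -ge0_integralZl//; last 2 first.
- by apply/measurable_EFinP; apply: measurableT_comp.
- by rewrite lee_fin mulr_ge0.
rewrite le_eqVlt; apply/orP; left; apply/eqP.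
apply: eq_integral => y _; rewrite /F /=.
under eq_integral do rewrite mulrC EFinM chi_omegaBC chi_omegaBE.
rewrite ge0_integralZl//; last by apply/measurable_EFinP; exact: measurable_indic.
rewrite muleC; congr (_ * _)%E.
rewrite integral_indic// setIT.
transitivity (@lebesgue_measure R `[y - xi, y + xi]%classic); first by [].
rewrite lebesgue_measure_itv.
rewrite /= lte_fin.
by case: ltP => [_|]; rewrite -?EFinB; [congr EFin; lra|move=> ?; congr EFin; lra].
Qed.

End ConvolutionChi.

(** * Mean value tools on the real line *)

Section RealDerivatives.
Variable R : realType.
Implicit Types f df : R -> R.

Lemma MVT_everywhere f df (a b : R) : (forall x : R, is_derive x 1 f (df x)) ->
  a <= b -> exists2 c : R, a <= c <= b & f b - f a = df c * (b - a).
Proof.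
move=> dfx ab.
have [|c cab E] := MVT_segment ab (fun x _ => dfx x).
  apply: continuous_subspaceT => x; apply: differentiable_continuous.
  by apply/derivable1_diffP; apply: ex_derive.
by exists c => //; move: cab; rewrite in_itv.
Qed.

Lemma is_derive_ge0_homo f df : (forall x : R, is_derive x 1 f (df x)) ->
  forall a b, a <= b -> (forall c, a <= c <= b -> 0 <= df c) -> f a <= f b.
Proof.
move=> dfx a b ab df0.
have [c acb E] := MVT_everywhere dfx ab.
by rewrite -subr_ge0 E mulr_ge0 ?subr_ge0 ?df0.
Qed.

Lemma is_derive_continuous f df : (forall x : R, is_derive x 1 f (df x)) ->
  continuous f.
Proof.
move=> dfx x; apply: differentiable_continuous.
by apply/derivable1_diffP; apply: ex_derive.
Qed.

Lemma is_derive_reflect f df (x : R) : is_derive (- x) 1 f (df (- x)) ->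
  is_derive x 1 (fun y => f (- y)) (- df (- x)).
Proof.
move=> d.
have dN : is_derive x (1 : R) (fun y : R => - y) (- 1) by apply: is_derive_eq.
by have := @is_derive1_comp _ f (fun y => - y) x _ _ d dN; rewrite mulrN1.
Qed.

Lemma powRN_lipschitz (p a b : R) : 0 < p -> 1 <= a -> 1 <= b ->
  `|a `^ (- p) - b `^ (- p)| <= p * `|a - b|.
Proof.
move=> p0; wlog ab : a b / a <= b => [H|] a1 b1.
  have [/H|/ltW/H] := leP a b; first exact.
  by rewrite distrC (distrC b); apply.
have [||c] := @MVT_segment R (@powR R ^~ (- p)) (fun x => - p * x `^ (- p - 1)) a b ab.
- move=> x; rewrite in_itv/= => /andP[ax _].
  by apply: is_derive1_powR; lra.
- apply: continuous_in_subspaceT => x; rewrite inE/= in_itv/= => /andP[ax _].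
  apply: differentiable_continuous; apply/derivable1_diffP/ex_derive.
  by apply: is_derive1_powR; lra.
- rewrite in_itv/= => /andP[ac cb] E.
  rewrite distrC E !normrM normrN (gtr0_norm p0) -mulrA ler_pM2l//.
  rewrite (distrC a) ler_piMl// ger0_norm ?powR_ge0//.
  by rewrite -[leRHS](powRr0 c); apply: ler_powR; lra.
Qed.

End RealDerivatives.

(** * The limit profile [Y]: parity, bounded slope, linear growth *)

Section Ybar.
Variables (R : realType) (m : R) (Y : R -> R).
Hypotheses (m0 : 0 < m) (hY : is_Ybar m Y).
Notation Y1 := (derive1 Y).
Implicit Types x y : R.
Let q (y : R) := 2 / (m + 1) * y `^ (- (m + 1)).

Lemma Ybar_gt0 x : 0 < Y x. Proof. by case: hY. Qed.

Lemma is_derive_Ybar x : is_derive x 1 Y (Y1 x).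
Proof. by case: hY => _ d _ _ _; rewrite derive1E; exact: derivableP. Qed.

Lemma is_derive_Ybar1 x :
  is_derive x 1 Y1 (2 / (m + 1) * Y x `^ (- (m + 1))).
Proof. by case: hY => _ _ d <- _; rewrite derive1E; exact: derivableP. Qed.

Lemma Ybar0 : Y 0 = 1. Proof. by case: hY => _ _ _ _ []. Qed.
Lemma Ybar1_0 : Y1 0 = 0. Proof. by case: hY => _ _ _ _ []. Qed.

Lemma Ybar2_gt0 x : 0 < 2 / (m + 1) * Y x `^ (- (m + 1)).
Proof. have m_gt0 := m0; apply: mulr_gt0; last exact: powR_gt0 (Ybar_gt0 x).
by apply: divr_gt0; lra.
Qed.

Lemma Ybar1_homo : {homo Y1 : x y / x <= y}.
Proof.
move=> x y xy; apply: (is_derive_ge0_homo is_derive_Ybar1 xy) => c _.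
exact/ltW/Ybar2_gt0.
Qed.

Lemma Ybar1_ge0 x : 0 <= x -> 0 <= Y1 x.
Proof. by move=> x0; rewrite -Ybar1_0 Ybar1_homo. Qed.

Lemma Ybar_ge1 x : 1 <= Y x.
Proof.
rewrite -Ybar0 -subr_ge0; have [x0|/ltW x0] := leP 0 x.
  have [c /andP[c0 _] ->] := MVT_everywhere is_derive_Ybar x0.
  by rewrite mulr_ge0 ?Ybar1_ge0// subr0.
have [c /andP[_ c0] E] := MVT_everywhere is_derive_Ybar x0.
have Y1c : Y1 c <= 0 by rewrite -Ybar1_0 Ybar1_homo.
rewrite -oppr_le0 opprB E sub0r mulr_le0_ge0//; lra.
Qed.

(* Gronwall for the odd part of [Y]: [s -> s^(-(m+1))] is Lipschitz on
   [1, +oo[, where [Y] takes its values. *)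
Lemma Ybar_even x : Y (- x) = Y x.
Proof.
wlog x0 : x / 0 <= x => [H|].
  have [/H//|/ltW x0] := leP 0 x.
  by rewrite -[in RHS](opprK x) (H (- x)) ?oppr_ge0.
have m_gt0 := m0.
pose D y := Y y - Y (- y).
pose D1 y := Y1 y + Y1 (- y).
pose D2 y := q (Y y) - q (Y (- y)).
have dD y : is_derive y 1 D (D1 y).
  rewrite /D /D1 -[X in _ + X]opprK.
  apply: is_deriveB; first exact: is_derive_Ybar.
  by apply: is_derive_reflect; exact: is_derive_Ybar.
have dD1 y : is_derive y 1 D1 (D2 y).
  apply: is_deriveD; first exact: is_derive_Ybar1.
  by apply: (is_derive_reflect (df := q \o Y)); exact: is_derive_Ybar1.
have D2D y : `|D2 y| <= 2 * `|D y|.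
  rewrite /D2 /q -mulrBr normrM gtr0_norm; last by rewrite divr_gt0//; lra.
  have -> : 2 * `|D y| = 2 / (m + 1) * ((m + 1) * `|D y|) by field; lra.
  rewrite ler_pM2l; last by rewrite divr_gt0//; lra.
  by apply: powRN_lipschitz; rewrite ?Ybar_ge1//; lra.
(* Since [|D2| <= 2 * |D|], the derivative [2 * D1 * (D + D2)] of [E] is at most
   [6 * |D * D1| <= 3 * E]. This gives the rate 3 in the exponential weight; the sign makes [F]
   nondecreasing from [F 0 = 0], which forces [E x <= 0]. *)
pose E y := D y ^+ 2 + D1 y ^+ 2.
pose F y := - (E y * expR (- 3 * y)).
pose F1 y := (3 * E y - 2 * D1 y * (D y + D2 y)) * expR (- 3 * y).
have dF y : is_derive y 1 F (F1 y).
  have ? := dD y; have ? := dD1 y.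
  rewrite /F /F1 /E; apply: is_derive_eq.
  by rewrite /GRing.scale /= /E; ring.
have F1_ge0 y : 0 <= F1 y.
  apply: mulr_ge0; last exact: expR_ge0.
  rewrite /E.
  have := D2D y; move: (D y) (D1 y) (D2 y) => a b c ca.
  have bc : b * c <= a ^+ 2 + b ^+ 2.
    apply: le_trans (ler_norm _) _; rewrite normrM.
    rewrite -(real_normK (num_real a)) -(real_normK (num_real b)).
    apply: le_trans (ler_wpM2l (normr_ge0 b) ca) _.
    by rewrite -subr_ge0; have := sqr_ge0 (`|a| - `|b|); congr (_ <= _); ring.
  suff -> : 3 * (a ^+ 2 + b ^+ 2) - 2 * b * (a + c) =
    (a - b) ^+ 2 + 2 * (a ^+ 2 + b ^+ 2 - b * c).
    by rewrite addr_ge0 ?sqr_ge0// mulr_ge0// subr_ge0.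
  by ring.
have : F 0 <= F x by apply: (is_derive_ge0_homo dF x0).
have -> : F 0 = 0.
  by rewrite /F /E /D /D1 oppr0 Ybar1_0 subrr addr0 !expr0n/= addr0 mul0r oppr0.
rewrite /F oppr_ge0 pmulr_lle0 ?expR_gt0// /E => le0.
have : D x ^+ 2 == 0.
  by rewrite eq_le sqr_ge0 andbT; have := sqr_ge0 (D1 x); lra.
by rewrite sqrf_eq0 /D subr_eq0 => /eqP.
Qed.

Lemma Ybar1_odd x : Y1 (- x) = - Y1 x.
Proof.
have d' := is_derive_reflect (is_derive_Ybar (- x)).
have E : (fun y => Y (- y)) = Y by apply/funext => y; exact: Ybar_even.
by move: d'; rewrite E => -[_]; rewrite -derive1E => ->; rewrite opprK.
Qed.

Lemma Ybar1_bounded : exists2 L : R, 0 < L & forall x, Y1 x <= L.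
Proof.
have m_gt0 := m0.
pose c := 4 / (m * (m + 1)).
have c0 : 0 < c by rewrite divr_gt0// mulr_gt0//; lra.
exists (1 + c); first lra.
have dE y : is_derive y 1 (fun x => Y1 x ^+ 2 + c * Y x `^ (- m)) 0.
  have ? := is_derive_Ybar y; have ? := is_derive_Ybar1 y.
  have ? : is_derive y 1 (fun x => Y x `^ (- m)) (- m * Y y `^ (- m - 1) * Y1 y).
    apply: (@is_derive1_comp _ (@powR R ^~ (- m)) Y).
    exact: is_derive1_powR (Ybar_gt0 y).
  apply: is_derive_eq.
  have -> : - m - 1 = - (m + 1) by ring.
  by rewrite /GRing.scale/= /c; field; lra.
move=> x.
have E : Y1 x ^+ 2 + c * Y x `^ (- m) = c.
  have -> := is_derive_0_is_cst x 0 dE.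
  by rewrite Ybar1_0 Ybar0 powR1 expr0n/= add0r mulr1.
have := mulr_ge0 (ltW c0) (powR_ge0 (Y x) (- m)).
have [|] := leP (Y1 x) 1; nra.
Qed.

(** The slope beyond 1 is at least [Y1 1 > 0] and [Y 1 >= 1]; the minimum of 1 and [Y1 1] absorbs
    both the offset and the slope. *)
Lemma Ybar_ge_linear : exists2 c : R, 0 < c & forall x, 1 <= x -> c * x <= Y x.
Proof.
have Y11 : 0 < Y1 1.
  have [c _] := MVT_everywhere is_derive_Ybar1 (@ler01 R).
  by rewrite Ybar1_0 subr0 subr0 mulr1 => ->; exact: Ybar2_gt0.
exists (Num.min 1 (Y1 1)); first by rewrite lt_min ltr01.
move=> x x1.
have [c /andP[c1 _] E] := MVT_everywhere is_derive_Ybar x1.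
have Yc := Ybar1_homo c1; have := Ybar_ge1 1.
have : Num.min 1 (Y1 1) <= 1 by rewrite ge_min lexx.
have : Num.min 1 (Y1 1) <= Y1 1 by rewrite ge_min lexx orbT.
move: (Num.min _ _) => t t1 t2 Y1_ge.
have : Y1 1 * (x - 1) <= Y1 c * (x - 1) by rewrite ler_wpM2r// subr_ge0.
by nra.
Qed.

Lemma Ybar_le_tangent x : 0 <= x -> Y x <= 1 + x * Y1 x.
Proof.
move=> x0; have [c /andP[_ cx] E] := MVT_everywhere is_derive_Ybar x0.
rewrite -lerBlDl -Ybar0 E subr0 mulrC ler_wpM2l//; exact: Ybar1_homo.
Qed.

(** By the equation for [Y] the right-hand side is [- Y'' / 2]. The kernel thus has the primitive
    [- Y' / 2], which makes its averages explicit. *)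
Lemma KbarE x : Kbar m Y x = - (1 / 2) * (2 / (m + 1) * Y x `^ (- (m + 1))).
Proof.
have m_gt0 := m0; rewrite /Kbar powRN invfM; field.
by rewrite gt_eqF ?powR_gt0 ?Ybar_gt0//; lra.
Qed.

Lemma is_derive_primitive_Kbar x :
  is_derive x 1 (fun y => - (1 / 2) * Y1 y) (Kbar m Y x).
Proof. by rewrite KbarE; have ? := is_derive_Ybar1 x; exact: is_derive_eq. Qed.

Lemma Kbar_continuous : continuous (Kbar m Y).
Proof.
move=> x; rewrite /continuous_at.
under eq_cvg do rewrite KbarE.
rewrite KbarE; apply: cvgM; first exact: cvg_cst.
apply: cvgM; first exact: cvg_cst.
apply: (@continuous_comp _ _ _ Y (@powR R ^~ (- (m + 1)))).
  exact: (is_derive_continuous is_derive_Ybar).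
apply: differentiable_continuous; apply/derivable1_diffP/ex_derive.
exact: is_derive1_powR (Ybar_gt0 x).
Qed.

End Ybar.

(** * Sizes of [xi] and [alpha_omega] for given [omega] *)

Section Scaling.
Variables (R : realType) (m : R) (Y : R -> R).
Hypotheses (m0 : 0 < m) (hY : is_Ybar m Y).
Notation Y1 := (derive1 Y).
Implicit Types omega xi : R.

Lemma delta_omega_gt0 omega : 0 < omega -> 0 < delta_omega m omega.
Proof. exact: powR_gt0. Qed.

Lemma delta_omega_le1 omega : 1 <= omega -> delta_omega m omega <= 1.
Proof.
move=> w1; rewrite -[leRHS](powRr0 omega); apply: ler_powR => //.
by rewrite oppr_le0 divr_ge0// ltW.
Qed.

Lemma delta_omega_powR omega : 0 < omega ->
  delta_omega m omega `^ (m / 2) = omega^-1.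
Proof.
have m_gt0 := m0; move=> w0; rewrite /delta_omega -powRrM.
have -> : - (2 / m) * (m / 2) = - 1 by field; lra.
by rewrite powR_inv1// ltW.
Qed.

Lemma is_xi_ge1 omega xi : is_xi m Y omega xi -> 1 <= xi. Proof. by case. Qed.

Lemma alpha_omega_gt0 omega xi : 0 < omega -> is_xi m Y omega xi ->
  0 < alpha_omega m omega xi.
Proof.
move=> w0 /is_xi_ge1 xi1; apply: powR_gt0.
by apply: mulr_gt0; [apply: mulr_gt0 => //; exact: delta_omega_gt0|lra].
Qed.

(** The defining equation of [xi], divided by its right-hand side and with the powers of
    [delta_omega] collected. The bounds on [xi], [alpha_omega] and the slope all start from this
    form. *)
Lemma xi_normalization omega xi : 0 < omega -> is_xi m Y omega xi ->
  delta_omega m omega * alpha_omega m omega xi * (xi * Y1 xi + Y xi) = 1.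
Proof.
have m_gt0 := m0; move=> w0 [xi1].
have d0 := delta_omega_gt0 w0.
rewrite /alpha_omega; move: (delta_omega m omega) d0 => d d0.
set S := _ + _ => E.
have -> : 2 * d * xi = d * (2 * xi) by ring.
rewrite powRM; [|lra|lra].
rewrite mulrA -[X in X * d `^ _](powRr1 (ltW d0)) -powRD; last by apply/implyP => _; rewrite gt_eqF.
have -> : 1 - 2 / (m + 2) = m / (m + 2) by field; lra.
rewrite mulrAC E -powRD; last by apply/implyP => _; rewrite gt_eqF//; lra.
by rewrite subrr powRr0.
Qed.

Lemma beta_omegaE omega xi : 0 < omega -> is_xi m Y omega xi ->
  delta_omega m omega * beta_omega m omega xi = (2 * xi)^-1.
Proof.
have m_gt0 := m0; move=> w0 /is_xi_ge1 xi1.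
have d0 := delta_omega_gt0 w0.
rewrite /beta_omega /alpha_omega; move: (delta_omega m omega) d0 => d d0.
rewrite -powRrM; have -> : - (2 / (m + 2)) * ((m + 2) / 2) = - 1 by field; lra.
rewrite powR_inv1; last by rewrite !mulr_ge0//; lra.
by field; lra.
Qed.

Lemma beta_alpha_omega omega xi : 0 < omega -> is_xi m Y omega xi ->
  beta_omega m omega xi * alpha_omega m omega xi `^ (- (m / 2)) =
  alpha_omega m omega xi.
Proof.
have m_gt0 := m0; move=> w0 hxi.
have a0 := alpha_omega_gt0 w0 hxi.
rewrite /beta_omega -powRD; last by apply/implyP => _; rewrite gt_eqF.
have -> : (m + 2) / 2 - m / 2 = 1 by field.
by rewrite powRr1// ltW.
Qed.

Lemma alpha_omega_eq omega xi : 0 < omega -> is_xi m Y omega xi ->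
  alpha_omega m omega xi `^ (- (m / 2)) =
  (2 * xi) * (delta_omega m omega * alpha_omega m omega xi).
Proof.
move=> w0 hxi; have xi1 := is_xi_ge1 hxi.
rewrite -[X in _ * (_ * X)](beta_alpha_omega w0 hxi).
transitivity (2 * xi * (delta_omega m omega * beta_omega m omega xi)
              * alpha_omega m omega xi `^ (- (m / 2))); last by rewrite !mulrA.
by rewrite (beta_omegaE w0 hxi) mulfV ?mul1r// gt_eqF//; lra.
Qed.

(** For [xi >= 1] the factor [xi * Y1 xi + Y xi] lies between [c * xi] and [(2 * L + 1) * xi], so
    the normalization pins [t = delta * alpha * xi] between two positive constants. As [2 * t] is
    the power [m / (m + 2)] of [2 * delta * xi], the product [delta * xi] is bounded above and away
    from 0, and [alpha = t / (delta * xi)] is bounded. *)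
Lemma xi_bounds : exists2 s : R, 0 < s & exists2 a : R, 0 < a &
  forall omega xi, 0 < omega -> is_xi m Y omega xi ->
  delta_omega m omega * xi <= s /\ alpha_omega m omega xi <= a.
Proof.
have m_gt0 := m0.
have [L L0 Y1L] := Ybar1_bounded m0 hY.
have [c c0 cY] := Ybar_ge_linear m0 hY.
pose s1 := (2 / (2 * L + 1)) `^ ((m + 2) / m).
pose s2 := (2 / c) `^ ((m + 2) / m).
have s1_gt0 : 0 < s1 by apply/powR_gt0/divr_gt0 => //; lra.
exists (s2 / 2); first by rewrite divr_gt0// powR_gt0// divr_gt0.
exists (2 / (c * s1)); first by rewrite divr_gt0// mulr_gt0.
move=> omega xi w0 hxi; have xi1 := is_xi_ge1 hxi.
have a0 := alpha_omega_gt0 w0 hxi.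
have E := xi_normalization w0 hxi.
have d0 := delta_omega_gt0 w0.
have xi_ge0 : 0 <= xi by lra.
have Y1_ge0 := Ybar1_ge0 m0 hY xi_ge0.
have Yle := Ybar_le_tangent m0 hY xi_ge0.
set t := delta_omega m omega * alpha_omega m omega xi * xi.
have t0 : 0 < t by rewrite !mulr_gt0//; lra.
have tc : t * c <= 1.
  rewrite -[leRHS]E /t -!mulrA !ler_pM2l// mulrC; have := cY _ xi1.
  by have := mulr_ge0 xi_ge0 Y1_ge0; lra.
have tL : 1 <= t * (2 * L + 1).
  rewrite -[leLHS]E /t -!mulrA !ler_pM2l//; have := Y1L xi.
  have : xi * Y1 xi <= xi * L by rewrite ler_wpM2l.
  by lra.
pose s := 2 * delta_omega m omega * xi.
have s0 : 0 < s by rewrite !mulr_gt0//; lra.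
have tE : s `^ (m / (m + 2)) = 2 * t.
  rewrite /t /alpha_omega -/s.
  have -> : m / (m + 2) = 1 + - (2 / (m + 2)) by field; lra.
  rewrite powRD; last by rewrite (gt_eqF s0) implybT.
  by rewrite powRr1 ?(ltW s0)// {1}/s; ring.
have sE : s = (2 * t) `^ ((m + 2) / m).
  rewrite -tE -powRrM; have -> : m / (m + 2) * ((m + 2) / m) = 1 by field; lra.
  by rewrite powRr1// ltW.
have p0 : 0 <= (m + 2) / m by rewrite divr_ge0//; lra.
have s_le : s <= s2.
  rewrite sE; apply: ge0_ler_powR => //; rewrite ?nnegrE; first lra.
    by rewrite divr_ge0// ltW.
  by rewrite ler_pdivlMr//; lra.
have s_ge : s1 <= s.
  rewrite sE; apply: ge0_ler_powR => //; rewrite ?nnegrE; last 2 first.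
  - lra.
  - by rewrite ler_pdivrMr//; lra.
  by rewrite divr_ge0//; lra.
split; first by move: s_le; rewrite /s; lra.
rewrite ler_pdivlMr ?mulr_gt0//.
have -> : alpha_omega m omega xi * (c * s1) = (alpha_omega m omega xi * c) * s1 by ring.
apply: (@le_trans _ _ (alpha_omega m omega xi * c * s)).
  by rewrite ler_pM2l// mulr_gt0.
by move: tc; rewrite /t /s; lra.
Qed.

(** By the normalization the left-hand side is [xi * Y1 xi / (xi * Y1 xi + Y xi)]; with [Y1 xi <= L]
    and [Y xi >= c * xi] this is at most [L / (L + c)]. Together with [Rbreve_ge] it keeps [Rbreve]
    away from the singularity at -1 outside [[- xi, xi]]. *)
Lemma xi_slope_bound : exists2 theta : R, theta < 1 &
  forall omega xi, 0 < omega -> is_xi m Y omega xi ->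
  delta_omega m omega * alpha_omega m omega xi * xi * Y1 xi <= theta.
Proof.
have m_gt0 := m0.
have [L L0 Y1L] := Ybar1_bounded m0 hY.
have [c c0 cY] := Ybar_ge_linear m0 hY.
exists (L / (L + c)); first by rewrite ltr_pdivrMr; lra.
move=> omega xi w0 hxi; have xi1 := is_xi_ge1 hxi.
have a0 := alpha_omega_gt0 w0 hxi; have d0 := delta_omega_gt0 w0.
rewrite ler_pdivlMr; last lra.
rewrite -[leRHS]mul1r -(xi_normalization w0 hxi) -!mulrA !ler_pM2l//.
have xi_ge0 : 0 <= xi by lra.
have := Ybar1_ge0 m0 hY xi_ge0; have := Y1L xi; have := cY _ xi1; have := Ybar_gt0 hY xi.
move: (Y xi) (Y1 xi) => y y1 y0 cy y1L y10.
suff : xi * c * y1 <= y * L by lra.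
by apply: ler_pM => //; [apply: mulr_ge0; lra|rewrite mulrC].
Qed.

End Scaling.

(** * First and second averages of the truncated kernel *)

Section ApproximateProfiles.
Variable R : realType.
Notation mu := (@lebesgue_measure R).

Lemma Rintegral_continuous_FTC2 (f F : R -> R) (a b : R) : a <= b ->
  continuous f -> (forall x : R, is_derive x 1 F (f x)) ->
  \int[mu]_(x in `[a, b]) f x = F b - F a.
Proof.
rewrite le_eqVlt => /predU1P[<-|ab] cf dF.
  by rewrite set_itv1 Rintegral_set1 subrr.
have cF := is_derive_continuous dF.
rewrite /Rintegral (@continuous_FTC2 _ f F)//; first exact: continuous_subspaceT.
- split; first by move=> x _; have [] := dF x.
  + by apply: cvg_at_right_filter; exact: cF.
  + by apply: cvg_at_left_filter; exact: cF.
- by move=> x _; rewrite derive1E; have [_ ->] := dF x.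
Qed.

Lemma convolution_chi_even (xi : R) (g : R -> R) (x : R) : 0 <= xi ->
  continuous g -> (forall y, g (- y) = g y) ->
  convolution (chi_omega xi) g (- x) = convolution (chi_omega xi) g x.
Proof.
move=> xi0 cg gN; rewrite !convolution_chiE.
have -> : - x - xi = - (x + xi) by ring.
have -> : - x + xi = - (x - xi) by ring.
rewrite /Rintegral integration_by_substitution_oppr; last 2 first.
- lra.
- exact: continuous_subspaceT.
by congr fine; apply: eq_integral => y _ /=; rewrite gN.
Qed.

Variables (m : R) (Y : R -> R).
Hypotheses (m0 : 0 < m) (hY : is_Ybar m Y).
Notation Y1 := (derive1 Y).
Implicit Types (xi c x : R).

(** For [xi >= 0], the projection onto [[- xi, xi]]. With it a single formula describes the average
    of the truncated kernel for every position of the window. *)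
Definition clamp xi x := Num.max (- xi) (Num.min x xi).

Lemma clamp_low xi x : 0 <= xi -> x <= - xi -> clamp xi x = - xi.
Proof. by move=> xi0 xl; rewrite /clamp min_l ?max_l//; lra. Qed.

Lemma clamp_id xi x : - xi <= x <= xi -> clamp xi x = x.
Proof. by move=> /andP[x1 x2]; rewrite /clamp min_l ?max_r. Qed.

Lemma clamp_high xi x : 0 <= xi -> xi <= x -> clamp xi x = xi.
Proof. by move=> xi0 xh; rewrite /clamp min_r ?max_r//; lra. Qed.

Lemma clampN xi x : 0 <= xi -> clamp xi (- x) = - clamp xi x.
Proof.
move=> xi0; have [xh|xh] := leP xi x.
  by rewrite (clamp_high xi0 xh) clamp_low//; lra.
have [xl|xl] := leP x (- xi).
  by rewrite (clamp_low xi0 xl) clamp_high//; lra.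
by rewrite !clamp_id//; apply/andP; split; lra.
Qed.

Lemma clamp_homo xi x y : x <= y -> clamp xi x <= clamp xi y.
Proof.
move=> xy; rewrite /clamp ge_max le_max lexx/= le_max; apply/orP; right.
by rewrite le_min !ge_min xy/= lexx orbT.
Qed.

Lemma chi_Kbar_segment_integrable xi c :
  segment_integrable (fun y => chi_omega xi y * c * Kbar m Y y).
Proof.
move=> a b.
have cK : continuous (fun y => c * Kbar m Y y).
  by move=> y; apply: cvgM; [exact: cvg_cst|exact: (Kbar_continuous m0 hY)].
apply: le_integrable (continuous_segment_integrable cK a b) => //.
  apply/measurable_EFinP/measurable_funTS.
  apply: measurable_funM; last exact: continuous_measurable_fun (Kbar_continuous m0 hY).
  by apply: measurable_funM => //; exact: measurable_indic.
move=> x _ /=; rewrite lee_fin -mulrA normrM ler_piMl//.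
by rewrite /chi_omega indicE; case: (_ \in _); rewrite ?normr1 ?normr0.
Qed.

(** If [|x| <= 2 * xi], the window meets [[- xi, xi]] in the segment with clamped endpoints, and the
    primitive [- Y1 / 2] is evaluated there. Otherwise the intersection is empty and both clamped
    endpoints coincide. *)
Lemma convolution_chi_Kbar xi c x : 0 <= xi ->
  convolution (chi_omega xi) (fun y => chi_omega xi y * c * Kbar m Y y) x =
  - (c / 2) * (Y1 (clamp xi (x + xi)) - Y1 (clamp xi (x - xi))).
Proof.
move=> xi0; rewrite convolution_chiE.
pose f y := c * Kbar m Y y.
have -> : \int[mu]_(y in `[x - xi, x + xi]) (chi_omega xi y * c * Kbar m Y y) =
    \int[mu]_(y in `[x - xi, x + xi] `&` `[- xi, xi]) f y.
  rewrite Rintegral_mkcondr; apply: eq_Rintegral => y _.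
  by rewrite patchE /chi_omega indicE; case: ifP => _; rewrite ?mul1r ?mul0r.
have -> : `[x - xi, x + xi] `&` `[- xi, xi] =
    `[Num.max (x - xi) (- xi), Num.min (x + xi) xi]%classic.
  apply/seteqP; split=> y /=; rewrite !in_itv/= ge_max le_min.
    by move=> [/andP[-> ->] /andP[-> ->]].
  by move=> /andP[/andP[-> ->] /andP[-> ->]].
have [xx|xx] := leP `|x| (2 * xi); last first.
  have [] : x < - (2 * xi) \/ 2 * xi < x.
  - by move: xx; case: ger0P => ? ?; [right|left]; lra.
  - move=> xlt; rewrite set_itv_ge ?Rintegral_set0.
      by rewrite !clamp_low ?subrr ?mulr0//; lra.
    rewrite bnd_simp -ltNge lt_max !gt_min.
    by apply/orP; right; apply/orP; left; lra.
  - move=> xlt; rewrite set_itv_ge ?Rintegral_set0.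
      by rewrite !clamp_high ?subrr ?mulr0//; lra.
    rewrite bnd_simp -ltNge lt_max !gt_min.
    by apply/orP; left; apply/orP; right; lra.
move: xx; rewrite ler_norml => /andP[x1 x2].
have -> : Num.max (x - xi) (- xi) = clamp xi (x - xi).
  by rewrite /clamp min_l 1?maxC//; lra.
have -> : Num.min (x + xi) xi = clamp xi (x + xi).
  by rewrite /clamp max_r// le_min; apply/andP; split; lra.
have cf : continuous f.
  by move=> y; apply: cvgM; [exact: cvg_cst|exact: (Kbar_continuous m0 hY)].
have df (y : R) : is_derive y 1 (fun z => c * (- (1 / 2) * Y1 z)) (f y).
  have ? := is_derive_primitive_Kbar m0 hY y.
  by apply: is_derive_eq; rewrite /GRing.scale/= /f.
have le_clamp : clamp xi (x - xi) <= clamp xi (x + xi) by apply: clamp_homo; lra.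
by rewrite (Rintegral_continuous_FTC2 le_clamp cf df); field.
Qed.

Section Profile.
Variables (xi c : R).
Hypotheses (xi0 : 0 < xi) (c0 : 0 <= c).
Let g y := chi_omega xi y * c * Kbar m Y y.
Let V := convolution (chi_omega xi) g.
Let W := convolution (chi_omega xi) V.

Lemma chi_Kbar_conv_continuous : continuous V.
Proof.
by apply: convolution_chi_continuous; [exact: chi_Kbar_segment_integrable|exact: ltW].
Qed.

Lemma chi_Kbar_conv_even x : V (- x) = V x.
Proof.
rewrite /V !convolution_chi_Kbar ?ltW//.
have -> : - x + xi = - (x - xi) by ring.
have -> : - x - xi = - (x + xi) by ring.
by rewrite !clampN ?ltW// !(Ybar1_odd m0 hY); ring.
Qed.

Lemma chi_Kbar_conv_inside x : 0 <= x <= 2 * xi ->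
  V x = - (c / 2) * (Y1 xi - Y1 (x - xi)).
Proof.
have xi_gt0 := xi0; move=> /andP[x1 x2].
rewrite /V convolution_chi_Kbar ?ltW//; congr (_ * (Y1 _ - Y1 _)).
  by rewrite clamp_high; lra.
by rewrite clamp_id; lra.
Qed.

Lemma chi_Kbar_conv_outside x : 2 * xi <= `|x| -> V x = 0.
Proof.
have xi_gt0 := xi0; wlog x0 : x / 0 <= x => [H|].
  have [/H//|x0 xx] := leP 0 x.
  by rewrite -chi_Kbar_conv_even H ?normrN//; lra.
rewrite ger0_norm// => xx; rewrite /V convolution_chi_Kbar ?ltW//.
by rewrite !clamp_high ?subrr ?mulr0//; lra.
Qed.

Lemma chi_Kbar_conv_le0 x : V x <= 0.
Proof.
have xi_gt0 := xi0.
rewrite /V (convolution_chi_Kbar _ _ (ltW xi0)); apply: mulr_le0_ge0.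
  by rewrite oppr_le0 divr_ge0.
rewrite subr_ge0; apply: (Ybar1_homo m0 hY); apply: clamp_homo; lra.
Qed.

Lemma chi_Kbar_conv2_even x : W (- x) = W x.
Proof.
by apply: convolution_chi_even;
  [exact: ltW|exact: chi_Kbar_conv_continuous|exact: chi_Kbar_conv_even].
Qed.

Lemma chi_Kbar_conv2_outside x : 3 * xi <= `|x| -> W x = 0.
Proof.
have xi_gt0 := xi0; wlog x0 : x / 0 <= x => [H|].
  have [/H//|x0 xx] := leP 0 x.
  by rewrite -chi_Kbar_conv2_even H ?normrN//; lra.
rewrite ger0_norm// => xx; rewrite /W convolution_chiE.
rewrite (@eq_Rintegral _ _ _ _ _ (cst 0)) ?Rintegral_cst// ?mul0r//.
move=> y; rewrite inE/= in_itv/= => /andP[y1 _].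
by apply: chi_Kbar_conv_outside; apply: le_trans (ler_norm _); lra.
Qed.

Lemma chi_Kbar_conv2_le0 x : W x <= 0.
Proof.
rewrite /W convolution_chiE -oppr_ge0 -mulN1r -RintegralZl//.
  by apply: Rintegral_ge0 => y _; rewrite mulN1r oppr_ge0 chi_Kbar_conv_le0.
exact: continuous_segment_integrable chi_Kbar_conv_continuous _ _.
Qed.

(** For [x >= xi] the window lies in the half-line of nonnegative numbers. As [V <= 0] vanishes
    beyond [2 * xi], the average is at least the integral of [V] over [[0, 2 * xi]], which is
    computed exactly. *)
Lemma chi_Kbar_conv2_ge x : xi <= `|x| -> - (c * xi * Y1 xi) <= W x.
Proof.
have xi_gt0 := xi0; wlog x0 : x / 0 <= x => [H|].
  have [/H//|x0 xx] := leP 0 x.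
  by rewrite -chi_Kbar_conv2_even H ?normrN//; lra.
rewrite ger0_norm// => xx.
have iV : segment_integrable V.
  exact: continuous_segment_integrable chi_Kbar_conv_continuous.
rewrite /W (convolution_chi_primitive (a := 0) iV); [|lra|lra].
have -> : \int[mu]_(y in `[0, x + xi]) V y = \int[mu]_(y in `[0, 2 * xi]) V y.
  apply/eqP; rewrite -subr_eq0 Rintegral_itvB; last 3 first.
  - exact: iV.
  - by rewrite bnd_simp; lra.
  - by rewrite bnd_simp; lra.
  rewrite (@eq_Rintegral _ _ _ _ _ (cst 0)) ?Rintegral_cst// ?mul0r//.
  move=> y; rewrite inE/= in_itv/= => /andP[y1 _].
  by apply: chi_Kbar_conv_outside; apply: le_trans (ler_norm _); lra.
have -> : \int[mu]_(y in `[0, 2 * xi]) V y = - (c * xi * Y1 xi).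
  pose f y := - (c / 2) * (Y1 xi - Y1 (y - xi)).
  pose F y := - (c / 2) * (y * Y1 xi - Y (y - xi)).
  transitivity (\int[mu]_(y in `[0, 2 * xi]) f y).
    apply: eq_Rintegral => y; rewrite inE/= in_itv/= => y02.
    exact: chi_Kbar_conv_inside.
  have cf : continuous f.
    move=> y; apply: cvgM; first exact: cvg_cst.
    apply: cvgB; first exact: cvg_cst.
    apply: (@continuous_shift_at _ Y1).
    exact: (is_derive_continuous (is_derive_Ybar1 hY)).
  have df (y : R) : is_derive y 1 F (f y).
    have ? := is_derive_shift (is_derive_Ybar hY (y - xi)).
    by apply: is_derive_eq; rewrite /GRing.scale/= /f; ring.
  have xi2 : 0 <= 2 * xi by lra.
  (* Evenness cancels the boundary terms [Y xi] and [Y (- xi)]. *)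
  rewrite (Rintegral_continuous_FTC2 xi2 cf df) /F mul0r !sub0r (Ybar_even m0 hY).
  have -> : 2 * xi - xi = xi by ring.
  by field.
rewrite lerBrDr gerDl -oppr_ge0 -mulN1r -RintegralZl//.
by apply: Rintegral_ge0 => y _; rewrite mulN1r oppr_ge0 chi_Kbar_conv_le0.
Qed.

End Profile.
End ApproximateProfiles.

(** * Formulas and bounds for [Rbreve] and [Vbreve] *)

Section Breve.
Variables (R : realType) (m : R) (Y : R -> R) (omega xi : R).
Hypotheses (m0 : 0 < m) (hY : is_Ybar m Y).
Hypotheses (w0 : 0 < omega) (hxi : is_xi m Y omega xi).
Notation delta := (delta_omega m omega).
Notation alpha := (alpha_omega m omega xi).
Notation Y1 := (derive1 Y).

(** The scalar [delta * alpha] is grouped so that this is the truncated kernel above with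
    [c = delta * alpha]. *)
Definition acceleration_breve (y : R) :=
  chi_omega xi y * (delta * alpha) * Kbar m Y y.
Notation gb := acceleration_breve.

Let xi_gt0 : 0 < xi.
Proof. exact: lt_le_trans ltr01 (is_xi_ge1 hxi). Qed.

Lemma acceleration_breve_integrable : segment_integrable gb.
Proof. exact: chi_Kbar_segment_integrable. Qed.

Lemma delta_alpha_ge0 : 0 <= delta * alpha.
Proof. by apply: mulr_ge0; apply: ltW; [exact: delta_omega_gt0|exact: alpha_omega_gt0 hxi]. Qed.

Lemma RbreveE : Rbreve m Y omega xi =
  convolution (chi_omega xi) (convolution (chi_omega xi) gb).
Proof.
rewrite /Rbreve; congr (convolution _ (convolution _ _)).
by apply/funext => y; rewrite /gb mulrA.
Qed.

Lemma VbreveE x : Vbreve m Y omega xi x =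
  - (2 * xi * omega) * convolution (chi_omega xi) gb x.
Proof.
rewrite /Vbreve /gb !(convolution_chi_Kbar m0 hY)// ?ltW//.
by rewrite (alpha_omega_eq m0 w0 hxi); ring.
Qed.

Lemma Vbreve_even x : Vbreve m Y omega xi (- x) = Vbreve m Y omega xi x.
Proof. by rewrite !VbreveE (chi_Kbar_conv_even m0 hY). Qed.

Lemma Rbreve_Vbreve x : Rbreve m Y omega xi x =
  - omega^-1 * convolution (chi_omega xi)
    (fun y => delta * beta_omega m omega xi * Vbreve m Y omega xi y) x.
Proof.
have xi_pos := xi_gt0; have w_pos := w0.
rewrite RbreveE (beta_omegaE m0 w0 hxi).
have -> : (fun y => (2 * xi)^-1 * Vbreve m Y omega xi y) =
    (fun y => - omega * convolution (chi_omega xi) gb y).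
  by apply/funext => y; rewrite VbreveE; field; lra.
rewrite convolution_chiZ; last first.
  exact/continuous_segment_integrable/chi_Kbar_conv_continuous.
by field; lra.
Qed.

Lemma Vbreve_inside x : 0 <= x <= 2 * xi -> Vbreve m Y omega xi x =
  - (1 / 2) * omega * alpha `^ (- (m / 2)) * (Y1 (x - xi) - Y1 xi).
Proof.
move=> xx; rewrite VbreveE (chi_Kbar_conv_inside m0 hY)//.
by rewrite (alpha_omega_eq m0 w0 hxi); field.
Qed.

Lemma Vbreve_outside x : 2 * xi <= x -> Vbreve m Y omega xi x = 0.
Proof.
move=> xx; rewrite VbreveE (chi_Kbar_conv_outside m0 hY) ?mulr0//.
exact: le_trans (ler_norm _).
Qed.

Lemma Rbreve_le0 x : Rbreve m Y omega xi x <= 0.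
Proof.
rewrite RbreveE; apply: (chi_Kbar_conv2_le0 m0 hY) => //.
exact: delta_alpha_ge0.
Qed.

Lemma Rbreve_outside x : 3 * xi <= `|x| -> Rbreve m Y omega xi x = 0.
Proof. by move=> xx; rewrite RbreveE (chi_Kbar_conv2_outside m0 hY). Qed.

Lemma Rbreve_ge x : xi <= `|x| ->
  - (delta * alpha * xi * Y1 xi) <= Rbreve m Y omega xi x.
Proof.
move=> xx; rewrite RbreveE; apply: (chi_Kbar_conv2_ge m0 hY) => //.
exact: delta_alpha_ge0.
Qed.

End Breve.

(** * Continuity and linear bounds for the force [dPhi 1 Phi] *)

Section PotentialDerivative.
Variable R : realType.

(** A convergent difference quotient is eventually smaller than [|l| + 1], where [l] is its limit;
    the excluded point [y = x] is trivial. *)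
Lemma derivable_within_lipschitz (A : set R) (f : R -> R) (x : R) :
  derivable_within A f x -> exists2 M : R, 0 < M &
  \forall y \near x, A y -> `|f y - f x| <= M * `|y - x|.
Proof.
move=> /cvg_ex[l /= fl].
have : \forall y \near within A x^', `|difference_quotient f x y| < `|l| + 1.
  have := fl => /cvgr_norm_lt; apply; by rewrite ltrDl.
rewrite near_withinE near_withinE => H.
exists (`|l| + 1); first by rewrite ltr_wpDl.
apply: filterS H => y H Ay.
have [->|yx] := eqVneq y x; first by rewrite !subrr normr0 mulr0.
have yx0 : 0 < `|y - x| by rewrite normr_gt0 subr_eq0.
by have := H yx Ay; rewrite /difference_quotient normrM normfV ltr_pdivrMr// => /ltW.
Qed.

Lemma derivable_within_comp_continuous (A : set R) (f r : R -> R) :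
  (forall x, A x -> derivable_within A f x) -> (forall x, A (r x)) ->
  continuous r -> continuous (f \o r).
Proof.
move=> df Ar cr x.
have [M M0 H] := derivable_within_lipschitz (df _ (Ar x)).
apply/cvgrPdist_le => e e0.
have {}H : \forall y \near x, `|f (r y) - f (r x)| <= M * `|r y - r x|.
  have H1 : \forall y \near x, A (r y) ->
      `|f (r y) - f (r x)| <= M * `|r y - r x| := cr x _ H.
  by apply: filterS H1 => y; apply; exact: Ar.
have e1 : 0 < e / M by rewrite divr_gt0.
have := cr x => /cvgrPdist_le /(_ _ e1) H2.
near=> y; rewrite distrC; apply: (@le_trans _ _ (M * `|r y - r x|)).
  by near: y.
by rewrite mulrC -ler_pdivlMr// distrC; near: y.
Unshelve. all: by end_near. Qed.

(** Within distance [e] of 0 the Lipschitz bound at 0 applies, as [f 0 = 0]. Farther away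
    [|x| >= e], so the maximum of [|f|] over the segment divided by [e] suffices. The constant adds
    both. *)
Lemma derivable_within_segment_linear (A : set R) (f : R -> R) (a : R) :
  `[a, 0]%classic `<=` A -> a <= 0 -> (forall x, A x -> derivable_within A f x) ->
  f 0 = 0 -> exists2 C : R, 0 < C & forall x, a <= x <= 0 -> `|f x| <= C * `|x|.
Proof.
move=> aA a0 df f0.
have A0 : A 0 by apply: aA; rewrite /= in_itv/= a0 lexx.
have [M M0 /nbhs_ballP[e /= e0 H]] := derivable_within_lipschitz (df _ A0).
have cf : {within `[a, 0], continuous (fun x => `|f x|)}.
  apply/subspace_continuousP => x xa; apply: cvg_norm.
  have [N N0 HN] := derivable_within_lipschitz (df _ (aA _ xa)).
  apply/cvgrPdist_le => d d0.
  rewrite near_withinE; near=> y => ya.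
  rewrite distrC; apply: (@le_trans _ _ (N * `|y - x|)).
    by move: (aA _ ya); near: y.
  rewrite mulrC -ler_pdivlMr// distrC; near: y.
  by apply: cvgr_dist_le; [exact: cvg_id|rewrite divr_gt0].
have [c ca Hc] := EVT_max a0 cf.
exists (M + `|f c| / e); first by rewrite ltr_wpDr// divr_ge0// ltW.
move=> x xa.
have xa' : x \in `[a, 0] by rewrite in_itv.
rewrite mulrDl; have [xe|xe] := ltP `|x| e.
  apply: ler_wpDr; first by rewrite mulr_ge0// divr_ge0// ltW.
  have := H x; rewrite f0 !subr0; apply; last exact: aA.
  by rewrite /ball/= sub0r normrN.
apply: ler_wpDl; first by rewrite mulr_ge0// ltW.
apply: le_trans (Hc _ xa') _.
by rewrite mulrAC ler_pdivlMr// ler_wpM2l.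
Unshelve. all: by end_near. Qed.

Variables (m k CPhi : R) (Phi : R -> R).
Hypothesis hPhi : potential m k CPhi Phi.

Lemma dPhi1_derivable_within x : @dom_Phi R x ->
  derivable_within (@dom_Phi R) (dPhi 1 Phi) x.
Proof. by case: hPhi => _ _ _ _ _ [/(_ 1%N) + _] _ _ _ _ _ _; apply. Qed.

Lemma dPhi1_comp_continuous (r : R -> R) : (forall x, -1 < r x <= 0) ->
  continuous r -> continuous (dPhi 1 Phi \o r).
Proof.
move=> r10; apply: (@derivable_within_comp_continuous (@dom_Phi R)).
  exact: dPhi1_derivable_within.
by move=> x; rewrite /dom_Phi /= in_itv/=.
Qed.

Lemma dPhi1_linear_bound e : 0 < e <= 1 -> exists2 C : R, 0 < C &
  forall r, - 1 + e <= r <= 0 -> `|dPhi 1 Phi r| <= C * `|r|.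
Proof.
move=> /andP[e0 e1]; apply: (@derivable_within_segment_linear (@dom_Phi R)).
- by move=> x /=; rewrite /dom_Phi /= !in_itv/= => /andP[? ->]; rewrite andbT; lra.
- lra.
- exact: dPhi1_derivable_within.
- by case: hPhi.
Qed.

End PotentialDerivative.

(** * Countable exceptional sets and the second difference *)

Section OffCountable.
Variable R : realType.
Notation mu := (@lebesgue_measure R).
Implicit Types (F : set R) (f g h : R -> R).

Lemma ae_off_countable F (P : R -> Prop) : countable F ->
  (forall x, ~ F x -> P x) -> \forall x \ae mu, P x.
Proof.
move=> cF FP; exists F; split.
- by apply: countable_measurable => // t; exact: measurable_set1.
- exact: countable_lebesgue_measure0.
- by move=> x /= nP; apply: contrapT => /FP.
Qed.

(** Every subset of a countable set is measurable, so arbitrary values on [F] are harmless. This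
    handles [derive1] at the finitely many points where no derivative has been computed. *)
Lemma measurable_off_countable F f g : countable F ->
  measurable_fun [set: R] g -> (forall x, ~ F x -> f x = g x) ->
  measurable_fun [set: R] f.
Proof.
move=> cF mg fg _ B mB; rewrite setTI.
have mF E : E `<=` F -> measurable E.
  move=> EF; apply: countable_measurable; first by move=> t; exact: measurable_set1.
  exact: sub_countable (subset_card_le EF) cF.
have -> : f @^-1` B = (g @^-1` B `\` F) `|` (f @^-1` B `&` F).
  apply/seteqP; split => x /=.
    by move=> fB; have [Fx|nFx] := pselect (F x); [right|left; rewrite -fg].
  by move=> [[gB nFx]|[]//]; rewrite fg.
apply: measurableU; last by apply: mF => x [].
apply: measurableD; last exact: mF.
by rewrite -[_ @^-1` _]setTI; exact: mg.
Qed.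

Lemma Lpnorm1_off_countable F f g : countable F ->
  measurable_fun [set: R] g -> (forall x, ~ F x -> f x = g x) ->
  Lpnorm 1 f = (\int[mu]_x `|g x|%:E)%E.
Proof.
move=> cF mg fg; rewrite /Lpnorm Lnorm1.
have mf := measurable_off_countable cF mg fg.
apply: ge0_ae_eq_integral => //.
- by apply: measurableT_comp => //; exact/measurable_EFinP.
- by apply/measurable_EFinP; exact: measurableT_comp.
- by apply: ae_off_countable cF _ => x nFx _ /=; rewrite fg.
Qed.

Lemma measurable_shift h (c : R) : measurable_fun [set: R] h ->
  measurable_fun [set: R] (fun x => h (x + c)).
Proof.
move=> mh; apply: (measurableT_comp mh).
by apply: measurable_funD => //; exact: measurable_cst.
Qed.

Lemma norm1_shift h (c : R) : measurable_fun [set: R] h ->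
  (\int[mu]_x `|h (x + c)%R|%:E = \int[mu]_x `|h x|%:E)%E.
Proof.
move=> mh; apply: (@ge0_integral_shift _ c (fun x => `|h x|%:E)) => //.
by apply/measurable_EFinP; exact: measurableT_comp.
Qed.

Lemma measurable_norm_outside h (xi : R) : measurable_fun [set: R] h ->
  measurable_fun [set: R] (fun x => `|h x| * (xi < `|x|)%R%:R).
Proof.
move=> mh; apply: measurable_funM; first exact: measurableT_comp.
have -> : (fun x : R => (xi < `|x|)%R%:R) = \1_([set x : R | xi < `|x|]) :> (R -> R).
  by apply/funext => x; rewrite indicE mem_setE.
apply: measurable_indic.
have mN : measurable_fun [set: R] (fun x : R => `|x|).
  exact: continuous_measurable_fun (@norm_continuous _ R).
have := mN measurableT _ (measurable_itv `]xi, +oo[); rewrite setTI.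
by congr (measurable _); apply/seteqP; split => x /=; rewrite in_itv/= andbT.
Qed.

(* Shifting by [2 * xi] moves the interior of [[- xi, xi]] off itself, so there
   the second difference determines [h] up to its values outside. *)
Lemma second_difference_norm1 h (xi : R) : 0 < xi -> measurable_fun [set: R] h ->
  (2%:E * \int[mu]_x `|h x|%:E <=
   \int[mu]_x `|h (x + 2 * xi) - 2 * h x + h (x - 2 * xi)|%:E +
   4%:E * \int[mu]_x (`|h x| * (xi < `|x|)%R%:R)%:E)%E.
Proof.
move=> xi0 mh.
pose u x := `|h x| * (xi < `|x|)%R%:R.
have u0 x : 0 <= u x by rewrite mulr_ge0.
have mn : measurable_fun [set: R] (fun x => `|h x|) by exact: measurableT_comp.
have mu_ : measurable_fun [set: R] u by exact: measurable_norm_outside.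
pose S x := h (x + 2 * xi) - 2 * h x + h (x - 2 * xi).
have mS : measurable_fun [set: R] S.
  apply: measurable_funD; last exact: measurable_shift.
  apply: measurable_funB; first exact: measurable_shift.
  by apply: measurable_funM => //; exact: measurable_cst.
have mES : measurable_fun [set: R] (fun x => `|S x|%:E).
  by apply/measurable_EFinP; exact: measurableT_comp.
have mEu : measurable_fun [set: R] (fun x => (u x)%:E) by exact/measurable_EFinP.
have mEuc c : measurable_fun [set: R] (fun x => (u (x + c))%:E).
  by apply/measurable_EFinP; exact: measurable_shift.
have uE c : (\int[mu]_x (u (x + c)%R)%:E = \int[mu]_x (u x)%:E)%E.
  by apply: (@ge0_integral_shift _ c (fun x => (u x)%:E)).
(* The factor 4 is 2 + 1 + 1: almost everywhere [2 * |h x|] is at most [|S x| + 2 * u x + u (x + 2 *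
   xi) + u (x - 2 * xi)], and all translates of [u] have the same integral. *)
have E4 : (4%:E * \int[mu]_x (u x)%:E = \int[mu]_x (2%:E * (u x)%:E) +
    \int[mu]_x (u (x + 2 * xi)%R)%:E + \int[mu]_x (u (x + - (2 * xi))%R)%:E)%E.
  rewrite !uE ge0_integralZl//; last by move=> x _; rewrite lee_fin.
  have -> : 4 = 2 + 1 + 1 :> R by ring.
  rewrite (EFinD (2 + 1) 1) (EFinD 2 1).
  have I0 : (0 <= \int[mu]_x (u x)%:E)%E by apply: integral_ge0 => x _; rewrite lee_fin.
  rewrite ge0_muleDl//; last by rewrite -EFinD lee_fin.
  by rewrite ge0_muleDl// !mul1e.
rewrite E4 -ge0_integralZl//; last exact/measurable_EFinP.
have m2u : measurable_fun [set: R] (fun x => 2%:E * (u x)%:E)%E.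
  by apply/measurable_EFinP; apply: measurable_funM => //; exact: measurable_cst.
have p2u x : (0 <= 2%:E * (u x)%:E)%E by rewrite -EFinM lee_fin mulr_ge0.
have pS x : (0 <= `|S x|%:E)%E by rewrite lee_fin.
have puc c x : (0 <= (u (x + c))%:E)%E by rewrite lee_fin.
have m3 := emeasurable_funD m2u (mEuc (2 * xi)).
have m4 := emeasurable_funD m3 (mEuc (- (2 * xi))).
have p3 x : (0 <= 2%:E * (u x)%:E + (u (x + 2 * xi))%:E)%E by rewrite adde_ge0.
have p4 x : (0 <= 2%:E * (u x)%:E + (u (x + 2 * xi))%:E
    + (u (x + - (2 * xi)))%:E)%E by rewrite adde_ge0.
rewrite -(ge0_integralD mu measurableT (fun x _ => p2u x) m2u
  (fun x _ => puc (2 * xi) x) (mEuc (2 * xi))).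
rewrite -(ge0_integralD mu measurableT (fun x _ => p3 x) m3
  (fun x _ => puc (- (2 * xi)) x) (mEuc (- (2 * xi)))).
rewrite -(ge0_integralD mu measurableT (fun x _ => pS x) mES (fun x _ => p4 x) m4).
apply: ae_ge0_le_integral => //.
- by apply/measurable_EFinP; apply: measurable_funM => //; exact: measurable_cst.
- by move=> x _; rewrite adde_ge0.
- exact: emeasurable_funD.
(* At [xi] and [- xi] the cutoff [u] vanishes, and one of the two shifted points is again on the
   boundary, so these points are removed. *)
apply: (@ae_off_countable [set xi; - xi]).
  by apply: finite_set_countable; exact: finite_set2.
move=> x nx _; rewrite -!EFinM -!EFinD lee_fin.
have [xx|xx] := ltP xi `|x|.
  rewrite {1}/u xx mulr1.
  by have := u0 (x + 2 * xi); have := u0 (x + - (2 * xi)); have := normr_ge0 (S x); lra.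
have {xx} : `|x| < xi.
  rewrite lt_neqAle xx andbT; apply/eqP => xE; apply: nx.
  by move: xE; case: (ger0P x) => _ <-; [left|right; rewrite opprK].
rewrite ltr_norml => /andP[x1 x2].
have -> : u (x + 2 * xi) = `|h (x + 2 * xi)|.
  rewrite /u; have -> : xi < `|x + 2 * xi|; last by rewrite mulr1.
  by apply: lt_le_trans (ler_norm _); lra.
have -> : u (x + - (2 * xi)) = `|h (x - 2 * xi)|.
  rewrite /u; have -> : xi < `|x - 2 * xi|; last by rewrite mulr1.
  by rewrite -normrN; apply: lt_le_trans (ler_norm _); lra.
have E2 : 2 * h x = h (x + 2 * xi) + h (x - 2 * xi) - S x by rewrite /S; ring.
have -> : 2 * `|h x| = `|2 * h x| by rewrite normrM ger0_norm.
rewrite E2; apply: le_trans (ler_normB _ _) _.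
have := ler_normD (h (x + 2 * xi)) (h (x - 2 * xi)); have := u0 x.
by rewrite /S; lra.
Qed.

End OffCountable.

(** * The force discrepancy [h] behind both profile differences *)

Section Discrepancy.
Variables (R : realType) (m k CPhi : R) (Phi Y : R -> R) (omega xi : R).
Variable Rt : R -> R.
Hypotheses (hPhi : potential m k CPhi Phi) (hY : is_Ybar m Y).
Hypotheses (w0 : 0 < omega) (hxi : is_xi m Y omega xi).
Hypotheses (Rt10 : forall x, -1 < Rt x <= 0)
  (RtE : distance_profile_eq m Phi omega xi Rt).
Notation delta := (delta_omega m omega).
Notation alpha := (alpha_omega m omega xi).
Notation mu := (@lebesgue_measure R).
Notation gb := (acceleration_breve m Y omega xi).

Let m0 : 0 < m. Proof. by case: hPhi. Qed.
Let xi_gt0 : 0 < xi. Proof. exact: lt_le_trans ltr01 (is_xi_ge1 hxi). Qed.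
Let xi_ge0 : 0 <= xi. Proof. exact: ltW. Qed.

Definition acceleration (y : R) :=
  delta `^ (m + 2) * alpha `^ (m + 2) * dPhi 1 Phi (Rt y).
Notation g := acceleration.

Definition discrepancy (y : R) := g y - gb y.
Notation h := discrepancy.

Lemma acceleration_integrable : segment_integrable g.
Proof.
case: RtE => ig _; apply: segment_integrableZ.
exact: locally_integrable_segment_integrable.
Qed.

Lemma distance_profile_continuous : continuous Rt.
Proof.
case: RtE => _ ->; apply: convolution_chi_continuous => //.
apply: continuous_segment_integrable; apply: convolution_chi_continuous => //.
exact: acceleration_integrable.
Qed.

Lemma acceleration_continuous : continuous g.
Proof.
move=> x; apply: cvgM; first exact: cvg_cst.
exact: (dPhi1_comp_continuous hPhi Rt10 distance_profile_continuous).
Qed.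

Lemma chi_omega_locally_constant x : `|x| != xi ->
  \forall y \near x, chi_omega xi y = chi_omega xi x.
Proof.
move=> xN; have [xl|xl|/eqP] := ltgtP `|x| xi; last by rewrite (negbTE xN).
- have H : \forall y \near x, `|y| < xi.
    by apply: (@cvgr_norm_lt _ _ _ (nbhs x) _ id x) => //; exact: cvg_id.
  apply: filterS H => y yl; rewrite /chi_omega !indicE !mem_set//= in_itv/= -ler_norml ltW//.
- have H : \forall y \near x, xi < `|y|.
    by apply: (@cvgr_norm_gt _ _ _ (nbhs x) _ id x) => //; exact: cvg_id.
  apply: filterS H => y yl; rewrite /chi_omega !indicE !memNset//= in_itv/= -ler_norml;
    by apply/negP; rewrite -ltNge.
Qed.

Lemma acceleration_breve_continuous x : `|x| != xi -> {for x, continuous gb}.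
Proof.
move=> xN; have near_eq := chi_omega_locally_constant xN.
rewrite /continuous_at /acceleration_breve; apply: cvg_trans.
  apply: (@near_eq_cvg _ _ _ _ (fun y => chi_omega xi x * (delta * alpha) * Kbar m Y y)).
  by apply: filterS near_eq => y ->.
by apply: cvgM; [exact: cvg_cst|exact: (Kbar_continuous m0 hY)].
Qed.

Lemma discrepancy_integrable : segment_integrable h.
Proof.
apply: segment_integrableB; first exact: acceleration_integrable.
exact: acceleration_breve_integrable.
Qed.

Lemma discrepancy_continuous x : `|x| != xi -> {for x, continuous h}.
Proof.
move=> xN; apply: cvgB; first exact: acceleration_continuous.
exact: acceleration_breve_continuous.
Qed.

Lemma discrepancy_outside x : xi < `|x| -> h x = g x.
Proof.
move=> xx; rewrite /h /acceleration_breve /chi_omega indicE memNset ?mul0r ?subr0//=.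
by rewrite in_itv/= -ler_norml; apply/negP; rewrite -ltNge.
Qed.

Notation W := (fun x => Rt x - Rbreve m Y omega xi x).
Notation ch := (convolution (chi_omega xi) h).

Lemma convolution_discrepancyE x :
  ch x = convolution (chi_omega xi) g x - convolution (chi_omega xi) gb x.
Proof.
apply: convolution_chiB; first exact: acceleration_integrable.
exact: acceleration_breve_integrable.
Qed.

Lemma convolution_discrepancy_continuous : continuous ch.
Proof. by apply: convolution_chi_continuous => //; exact: discrepancy_integrable. Qed.

Lemma profile_differenceE : W = convolution (chi_omega xi) ch.
Proof.
apply/funext => x; rewrite RbreveE; case: RtE => _ {1}->.
rewrite -convolution_chiB; last 2 first.
- apply: continuous_segment_integrable; apply: convolution_chi_continuous => //.
  exact: acceleration_integrable.
- apply: continuous_segment_integrable; apply: convolution_chi_continuous => //.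
  exact: acceleration_breve_integrable.
by congr (convolution _ _ x); apply/funext => y; rewrite convolution_discrepancyE.
Qed.

Lemma profile_difference_continuous : continuous W.
Proof.
rewrite profile_differenceE; apply: convolution_chi_continuous => //.
exact/continuous_segment_integrable/convolution_discrepancy_continuous.
Qed.

Lemma profile_difference_derive1 : derive1 W = fun x => ch (x + xi) - ch (x - xi).
Proof.
apply/funext => x; rewrite profile_differenceE derive1E.
have iW := continuous_segment_integrable convolution_discrepancy_continuous.
by have [_ ->] := is_derive_convolution_chi iW xi_ge0
  (@convolution_discrepancy_continuous (x + xi))
  (@convolution_discrepancy_continuous (x - xi)).
Qed.

Lemma is_derive_convolution_discrepancy (x : R) :
  `|x + xi| != xi -> `|x - xi| != xi -> is_derive x 1 ch (h (x + xi) - h (x - xi)).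
Proof.
move=> xp xm; apply: is_derive_convolution_chi => //.
- exact: discrepancy_integrable.
- exact: discrepancy_continuous.
- exact: discrepancy_continuous.
Qed.

(** The excluded points are those where [x], [x + 2 * xi] or [x - 2 * xi] hits a jump of [gb] at
    [- xi] or [xi]. *)
Lemma profile_difference_derive2 x :
  ~ [set xi; - xi; 3 * xi; - (3 * xi)] x ->
  derive1 (derive1 W) x = h (x + 2 * xi) - 2 * h x + h (x - 2 * xi).
Proof.
move=> xN; rewrite profile_difference_derive1 derive1E.
have N0 : `|x| != xi.
  apply/eqP => xE; apply: xN; move: xE; case: ger0P => ? <- /=; [do 3 left|do 2 left; right] => //.
  by rewrite opprK.
have N1 : `|x + 2 * xi| != xi.
  apply/eqP => xE; apply: xN; move: xE; case: ger0P => ? ?; [do 2 left; right|right] => /=; lra.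
have N2 : `|x - 2 * xi| != xi.
  apply/eqP => xE; apply: xN; move: xE; case: ger0P => ? ?; [left; right|do 3 left] => /=; lra.
have e1 : x + xi + xi = x + 2 * xi by ring.
have e2 : x + xi - xi = x by ring.
have e3 : x - xi + xi = x by ring.
have e4 : x - xi - xi = x - 2 * xi by ring.
have dp : is_derive (x + xi) 1 ch (h (x + 2 * xi) - h x).
  have := @is_derive_convolution_discrepancy (x + xi); rewrite e1 e2; exact.
have dm : is_derive (x - xi) 1 ch (h x - h (x - 2 * xi)).
  have := @is_derive_convolution_discrepancy (x - xi); rewrite e3 e4; exact.
have [_ ->] := is_deriveB (is_derive_shift dp) (is_derive_shift dm).
by ring.
Qed.

(** Half of each exponent [m + 2] is split off: [delta]^ (m / 2)[is]1 / omega[,]alpha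
    [^ ((m + 2) / 2)] is [beta], and the remaining [delta * beta] is [1 / (2 * xi)]. *)
Lemma VtildeE x : Vtilde m Phi omega xi Rt x =
  - (2 * xi * omega) * convolution (chi_omega xi) g x.
Proof.
have m_pos := m0; have xi_pos := xi_gt0; have w_pos := w0.
have d0 := delta_omega_gt0 m w0; have a0 := alpha_omega_gt0 w0 hxi.
rewrite /Vtilde mulNr -convolution_chiZ; last exact: acceleration_integrable.
congr (- convolution _ _ x); apply/funext => y; rewrite /g !mulrA.
congr (_ * _).
have -> : delta `^ (m + 2) = omega^-1 * delta * delta `^ (m / 2 + 1).
  rewrite -(delta_omega_powR m0 w0) -[X in _ * X * _](powRr1 (ltW d0)).
  rewrite -!powRD; [|by apply/implyP => _; rewrite gt_eqF..].
  by congr (_ `^ _); field.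
have -> : alpha `^ (m + 2) = beta_omega m omega xi * alpha `^ (m / 2 + 1).
  rewrite /beta_omega -powRD; last by apply/implyP => _; rewrite gt_eqF.
  by congr (_ `^ _); field.
transitivity (2 * xi * (omega / omega) * (delta * beta_omega m omega xi) *
    (delta `^ (m / 2 + 1) * alpha `^ (m / 2 + 1))); last by ring.
rewrite (beta_omegaE m0 w0 hxi) mulfV ?mulr1 ?gt_eqF//.
by rewrite mulfV ?mul1r// gt_eqF//; lra.
Qed.

Notation dV := (fun x => omega^-1 * Vtilde m Phi omega xi Rt x
  - omega^-1 * Vbreve m Y omega xi x).
Notation dV' := (fun x => omega^-1 * derive1 (Vtilde m Phi omega xi Rt) x
  - omega^-1 * derive1 (Vbreve m Y omega xi) x).

Lemma velocity_differenceE x : dV x = - (2 * xi) * ch x.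
Proof.
have w_pos := w0.
rewrite VtildeE (VbreveE m0 hY w0 hxi) convolution_discrepancyE; field; lra.
Qed.

(** Both velocity profiles must be differentiated separately, as [dV'] subtracts their derivatives.
    The excluded points are those where [x + xi] or [x - xi] equals [- xi] or [xi]. *)
Lemma velocity_difference_derivativeE x : ~ [set 0; 2 * xi; - (2 * xi)] x ->
  dV' x = - (2 * xi) * (h (x + xi) - h (x - xi)).
Proof.
move=> xN; have w_pos := w0.
have Np : `|x + xi| != xi.
  apply/eqP => xE; apply: xN; move: xE; case: ger0P => ? ?; [do 2 left|right] => /=; lra.
have Nm : `|x - xi| != xi.
  apply/eqP => xE; apply: xN; move: xE; case: ger0P => ? ?; [left; right|do 2 left] => /=; lra.
have dg : is_derive x 1 (Vtilde m Phi omega xi Rt)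
    (- (2 * xi * omega) * (g (x + xi) - g (x - xi))).
  have -> : Vtilde m Phi omega xi Rt =
      (fun x => - (2 * xi * omega) * convolution (chi_omega xi) g x).
    by apply/funext => y; exact: VtildeE.
  have ? := is_derive_convolution_chi acceleration_integrable xi_ge0
    (@acceleration_continuous (x + xi)) (@acceleration_continuous (x - xi)).
  by apply: is_derive_eq; rewrite /GRing.scale.
have db : is_derive x 1 (Vbreve m Y omega xi)
    (- (2 * xi * omega) * (gb (x + xi) - gb (x - xi))).
  have -> : Vbreve m Y omega xi =
      (fun x => - (2 * xi * omega) * convolution (chi_omega xi) gb x).
    by apply/funext => y; exact: (VbreveE m0 hY w0 hxi).
  have ? := is_derive_convolution_chi (acceleration_breve_integrable omega xi m0 hY) xi_ge0
    (acceleration_breve_continuous Np) (acceleration_breve_continuous Nm).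
  by apply: is_derive_eq; rewrite /GRing.scale.
rewrite !derive1E; have [_ ->] := dg; have [_ ->] := db.
by rewrite /h; field; lra.
Qed.

End Discrepancy.

(** * The norm of order infinity as an essential supremum *)

Section SupNorm.
Variable R : realType.
Notation mu := (@lebesgue_measure R).

(** The definition of [Lnorm] at [+oo] gives the essential supremum only on a space of positive
    measure. *)
Lemma lebesgue_measureT_gt0 : (0 < mu [set: R])%E.
Proof.
apply: (@lt_le_trans _ _ (mu `[0%R, 1%R])).
  by rewrite lebesgue_measure_itv/= lte_fin ltr01 sube0 lte_fin.
by apply: le_measure; rewrite ?inE.
Qed.

Lemma ae_le_Lpnorm_infty (f : R -> R) :
  \forall x \ae mu, (`|f x|%:E <= Lpnorm +oo f)%E.
Proof.
rewrite /Lpnorm unlock lebesgue_measureT_gt0.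
exact: (ess_sup_ge mu (abse \o (EFin \o f))).
Qed.

Lemma Lpnorm_infty_le (f : R -> R) (M : \bar R) :
  (forall x, (`|f x|%:E <= M)%E) -> (Lpnorm +oo f <= M)%E.
Proof.
move=> fM; rewrite /Lpnorm unlock lebesgue_measureT_gt0.
by apply/ess_supP; apply: nearW => x /=; exact: fM.
Qed.

End SupNorm.

(** * The L1 bound on the discrepancy *)

Section Estimate.
Variables (R : realType) (m k CPhi : R) (Phi Y : R -> R) (omega xi : R).
Variable Rt : R -> R.
Hypotheses (hPhi : potential m k CPhi Phi) (hY : is_Ybar m Y).
Hypotheses (w0 : 0 < omega) (hxi : is_xi m Y omega xi).
Hypotheses (Rt10 : forall x, -1 < Rt x <= 0)
  (RtE : distance_profile_eq m Phi omega xi Rt).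
Notation delta := (delta_omega m omega).
Notation alpha := (alpha_omega m omega xi).
Notation mu := (@lebesgue_measure R).
Notation g := (acceleration m Phi omega xi Rt).
Notation h := (discrepancy m Phi Y omega xi Rt).
Notation W := (fun x => Rt x - Rbreve m Y omega xi x).

Let m0 : 0 < m. Proof. by case: hPhi. Qed.
Let xi_gt0 : 0 < xi. Proof. exact: lt_le_trans ltr01 (is_xi_ge1 hxi). Qed.
Let d0 : 0 < delta. Proof. exact: delta_omega_gt0. Qed.

Let mh : measurable_fun [set: R] h.
Proof. exact: segment_integrable_measurable (discrepancy_integrable hPhi hY RtE). Qed.

Lemma star_norm_le B : (star_norm m omega W <= B%:E)%E ->
  [/\ (\int[mu]_x `|h (x + 2 * xi) - 2 * h x + h (x - 2 * xi)|%:E <= B%:E)%E,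
      (\int[mu]_x `|W x|%:E <= (B / delta ^+ 2)%:E)%E &
      \forall x \ae mu, `|W x| <= B / delta].
Proof.
have d_pos := d0.
rewrite /star_norm.
set n0 := (`|_|%:E)%E; set n2 := Lpnorm 1 (derive1 _).
set n1 := Lpnorm 1 _; set ni := Lpnorm +oo _ => le_B.
have n0_ge0 : (0 <= n0)%E by rewrite lee_fin.
have n2_ge0 : (0 <= n2)%E by exact: Lnorm_ge0.
have n1_ge0 : (0 <= (delta ^+ 2)%:E * n1)%E.
  by rewrite mule_ge0 ?lee_fin ?sqr_ge0//; exact: Lnorm_ge0.
have ni_ge0 : (0 <= delta%:E * ni)%E.
  by rewrite mule_ge0 ?lee_fin ?(ltW d_pos)//; exact: Lnorm_ge0.
have le3 := le_trans (leeDl _ ni_ge0) le_B.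
have le2 := le_trans (leeDl _ n1_ge0) le3.
split.
- have <- : n2 = (\int[mu]_x `|h (x + 2 * xi) - 2 * h x + h (x - 2 * xi)|%:E)%E.
    apply: (@Lpnorm1_off_countable _ [set xi; - xi; 3 * xi; - (3 * xi)]).
    + by apply: finite_set_countable; exact: finite_set4.
    + apply: measurable_funD; last exact: measurable_shift.
      apply: measurable_funB; first exact: measurable_shift.
      by apply: measurable_funM => //; exact: measurable_cst.
    + exact: (profile_difference_derive2 hPhi hY hxi Rt10 RtE).
  exact: le_trans (leeDr _ n0_ge0) le2.
- have <- : n1 = (\int[mu]_x `|W x|%:E)%E by rewrite /n1 /Lpnorm Lnorm1.
  rewrite mulrC EFinM lee_pdivlMl ?exprn_gt0//.
  apply: le_trans le3; exact: leeDr (adde_ge0 n0_ge0 n2_ge0).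
- have Bi : (ni <= (B / delta)%:E)%E.
    rewrite mulrC EFinM lee_pdivlMl//.
    by apply: le_trans le_B; apply: leeDr; rewrite !adde_ge0.
  apply: (@filterS _ _ (ae_filter_ringOfSetsType mu)) (ae_le_Lpnorm_infty W) => x xn.
  by rewrite -lee_fin; exact: le_trans xn Bi.
Qed.

(** Outside [[- xi, xi]] one has [h = g], [Rbreve >= - 1 + 2 * e] and almost everywhere [|W| <= e].
    Hence [Rt >= - 1 + e], and the linear bound on the force applies there. *)
Lemma discrepancy_norm1_le (B C e : R) : 0 < C -> 0 < e ->
  (forall r, - 1 + e <= r <= 0 -> `|dPhi 1 Phi r| <= C * `|r|) ->
  delta * alpha * xi * derive1 Y xi <= 1 - 2 * e ->
  B / delta <= e ->
  (star_norm m omega W <= B%:E)%E ->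
  (2%:E * \int[mu]_x `|h x|%:E <=
   (B + 4 * (delta `^ (m + 2) * alpha `^ (m + 2) * C
             * (6 * xi + B / delta ^+ 2)))%:E)%E.
Proof.
move=> C0 e0 linear slope Be /star_norm_le[S_le W_le W_ae].
have xi_pos := xi_gt0.
apply: le_trans (second_difference_norm1 xi_gt0 mh) _.
rewrite [leRHS]EFinD; apply: leeD => //.
rewrite [leRHS]EFinM lee_pmul2l//.
set c := delta `^ (m + 2) * alpha `^ (m + 2) * C.
have c0 : 0 <= c by rewrite !mulr_ge0 ?powR_ge0// ltW.
have mW : measurable_fun [set: R] W.
  exact: continuous_measurable_fun (profile_difference_continuous hPhi hY hxi RtE).
(* Majorant from [|Rt| <= |Rbreve| + |W|]: outside [[- xi, xi]], [|Rbreve|] is at most 1, and it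
   vanishes beyond [3 * xi]. The indicator contributes the length [6 * xi]. *)
pose v x := c * (\1_(`[- (3 * xi), 3 * xi]%classic) x + `|W x|).
have mi : measurable_fun [set: R] (\1_(`[- (3 * xi), 3 * xi]%classic) : R -> R).
  exact: measurable_indic.
have mnW : measurable_fun [set: R] (fun x => `|W x|) by exact: measurableT_comp.
have ind0 x : 0 <= \1_(`[- (3 * xi), 3 * xi]%classic) x :> R by rewrite indicE.
have -> : (c * (6 * xi + B / delta ^+ 2))%:E =
    (c%:E * ((6 * xi)%:E + (B / delta ^+ 2)%:E))%E by rewrite -EFinD -EFinM.
apply: (@le_trans _ _ (\int[mu]_x (v x)%:E)%E); last first.
  have -> : (\int[mu]_x (v x)%:E = c%:E * (\int[mu]_x
      (\1_(`[- (3 * xi), 3 * xi]%classic) x)%:E + \int[mu]_x `|W x|%:E))%E.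
    rewrite -ge0_integralD//; last 2 first.
    - exact/measurable_EFinP.
    - exact/measurable_EFinP.
    rewrite -ge0_integralZl//.
    - exact/measurable_EFinP/measurable_funD.
    - by move=> x _; rewrite -EFinD lee_fin addr_ge0.
  apply: lee_wpmul2l; first by rewrite lee_fin.
  apply: leeD => //.
  rewrite integral_indic// setIT.
  have <- : mu `[- (3 * xi), 3 * xi]%classic = (6 * xi)%:E.
    rewrite lebesgue_measure_itv/= lte_fin ifT; last lra.
    by rewrite -EFinB; congr EFin; ring.
  exact: lexx.
have mu1 := measurable_norm_outside xi mh.
apply: ae_ge0_le_integral => //.
- exact/measurable_EFinP.
- by move=> x _; rewrite lee_fin mulr_ge0// addr_ge0.
- apply/measurable_EFinP; apply: measurable_funM; first exact: measurable_cst.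
  exact: measurable_funD.
apply: (@filterS _ _ (ae_filter_ringOfSetsType mu)) W_ae => x Wx _; rewrite lee_fin.
have [xx|_] := ltP xi `|x|; last by rewrite mulr0 mulr_ge0// addr_ge0.
rewrite mulr1 (discrepancy_outside _ _ _ _ _ xx) /acceleration normrM ger0_norm; last first.
  by rewrite mulr_ge0// powR_ge0.
rewrite /v /c -mulrA; apply: ler_wpM2l; first by rewrite mulr_ge0// powR_ge0.
have /andP[R1 R2] := Rt10 x.
have Rb_ge := Rbreve_ge m0 hY w0 hxi (ltW xx).
have Rb_le := Rbreve_le0 m0 hY w0 hxi x.
move: (Wx); rewrite ler_norml => /andP[W1 W2].
apply: (@le_trans _ _ (C * `|Rt x|)); first by apply: linear; rewrite R2 andbT; lra.
apply: ler_wpM2l; first exact: ltW.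
rewrite -{1}(subrK (Rbreve m Y omega xi x) (Rt x)).
apply: le_trans (ler_normD _ _) _; rewrite addrC; apply: lerD; last by [].
rewrite indicE; have [x3|/negP x3] := boolP (x \in `[- (3 * xi), 3 * xi]%classic).
  have -> : true%:R = 1 :> R by [].
  by rewrite ler0_norm//; lra.
rewrite (Rbreve_outside m0 hY hxi) ?normr0//.
move/negP: x3; rewrite notin_setE/= in_itv/= -ler_norml => /negP; rewrite -ltNge => /ltW.
exact.
Qed.

End Estimate.

(** * From the discrepancy to the velocity profiles *)

Section VelocityNorms.
Variables (R : realType) (m k CPhi : R) (Phi Y : R -> R) (omega xi : R).
Variable Rt : R -> R.
Hypotheses (hPhi : potential m k CPhi Phi) (hY : is_Ybar m Y).
Hypotheses (w0 : 0 < omega) (hxi : is_xi m Y omega xi).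
Hypotheses (Rt10 : forall x, -1 < Rt x <= 0)
  (RtE : distance_profile_eq m Phi omega xi Rt).
Notation delta := (delta_omega m omega).
Notation mu := (@lebesgue_measure R).
Notation h := (discrepancy m Phi Y omega xi Rt).
Notation ch := (convolution (chi_omega xi) h).
Notation dV := (fun x => omega^-1 * Vtilde m Phi omega xi Rt x
  - omega^-1 * Vbreve m Y omega xi x).
Notation dV' := (fun x => omega^-1 * derive1 (Vtilde m Phi omega xi Rt) x
  - omega^-1 * derive1 (Vbreve m Y omega xi) x).

Let xi_gt0 : 0 < xi. Proof. exact: lt_le_trans ltr01 (is_xi_ge1 hxi). Qed.

Let ih : segment_integrable h.
Proof. exact: discrepancy_integrable hPhi hY RtE. Qed.

Let mh : measurable_fun [set: R] h.
Proof. exact: segment_integrable_measurable ih. Qed.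

(** As [dV] is [- 2 * xi] times the average of [h], the three terms use the L1 bound [2 * xi * N]
    and the sup bound [N] for that average, and two translates of [h] for its derivative. *)
Lemma velocity_difference_norms_le (N : R) :
  (\int[mu]_x `|h x|%:E <= N%:E)%E ->
  (delta%:E * Lpnorm 1 dV + Lpnorm +oo dV + Lpnorm 1 dV' <=
   (delta * (2 * xi * (2 * xi * N)) + 2 * xi * N + 2 * xi * (N + N))%:E)%E.
Proof.
move=> hN; have xi2_ge0 : 0 <= 2 * xi by have := xi_gt0; lra.
have d0 : 0 < delta by exact: delta_omega_gt0.
have dVE : dV = fun x => - (2 * xi) * ch x.
  by apply/funext => x; exact: (velocity_differenceE hPhi hY w0 hxi RtE).
have cch := convolution_discrepancy_continuous hPhi hY hxi RtE.
rewrite [leRHS]EFinD [X in (_ <= X + _)%E]EFinD.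
apply: leeD; first apply: leeD.
- rewrite [leRHS]EFinM; apply: lee_wpmul2l; first by rewrite lee_fin ltW.
  rewrite dVE /Lpnorm Lnorm1 /=.
  under eq_integral do rewrite normrM normrN (ger0_norm xi2_ge0) EFinM.
  rewrite ge0_integralZl//; last first.
    by apply/measurable_EFinP; apply: measurableT_comp => //; exact: continuous_measurable_fun.
  rewrite [leRHS]EFinM; apply: lee_wpmul2l; first by rewrite lee_fin.
  apply: le_trans (convolution_chi_norm1 ih (ltW xi_gt0)) _.
  by rewrite [leRHS]EFinM; apply: lee_wpmul2l; rewrite ?lee_fin.
- rewrite dVE; apply: Lpnorm_infty_le => x.
  rewrite normrM normrN (ger0_norm xi2_ge0) (EFinM (2 * xi) N) EFinM.
  apply: lee_wpmul2l; first by rewrite lee_fin.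
  exact: le_trans (convolution_chi_le_norm1 _ _ ih) hN.
- pose k' x := - (2 * xi) * (h (x + xi) - h (x - xi)).
  have mhp := measurable_shift xi mh.
  have mhm := measurable_shift (- xi) mh.
  have mk : measurable_fun [set: R] k'.
    apply: measurable_funM; first exact: measurable_cst.
    exact: measurable_funB.
  rewrite (@Lpnorm1_off_countable _ [set 0; 2 * xi; - (2 * xi)] _ k' _ mk); last 2 first.
  + by apply: finite_set_countable; exact: finite_set3.
  + exact: (velocity_difference_derivativeE hPhi hY w0 hxi Rt10 RtE).
  have mEp : measurable_fun [set: R] (fun x => `|h (x + xi)|%:E).
    by apply/measurable_EFinP; exact: measurableT_comp.
  have mEm : measurable_fun [set: R] (fun x => `|h (x - xi)|%:E).
    by apply/measurable_EFinP; exact: measurableT_comp.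
  apply: (@le_trans _ _ (\int[mu]_x ((2 * xi)%:E *
      (`|h (x + xi)|%:E + `|h (x - xi)|%:E)))%E).
    apply: ge0_le_integral => //.
    - by apply/measurable_EFinP; exact: measurableT_comp.
    - apply/measurable_EFinP; apply: measurable_funM; first exact: measurable_cst.
      by apply: measurable_funD; exact: measurableT_comp.
    - move=> x _; rewrite -EFinD -EFinM lee_fin /k' normrM normrN (ger0_norm xi2_ge0).
      by apply: ler_wpM2l => //; exact: ler_normB.
  have mS := emeasurable_funD mEp mEm.
  rewrite ge0_integralZl//; last by move=> x _; rewrite adde_ge0.
  rewrite [leRHS]EFinM; apply: lee_wpmul2l; first by rewrite lee_fin.
  rewrite ge0_integralD//.
  rewrite (norm1_shift xi mh) (norm1_shift (- xi) mh) EFinD.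
  exact: leeD.
Qed.

End VelocityNorms.

(** * Large [omega] and the choice of constants *)

Lemma delta_omega_small (R : realType) (m t : R) : 0 < m -> 0 < t ->
  \forall omega \near pinfty_nbhs R, delta_omega m omega <= t.
Proof.
move=> m0 t0; near=> omega.
(* The threshold is the value of [omega] at which [delta_omega] equals [t]. *)
have wT : t^-1 `^ (m / 2) <= omega by near: omega; apply: nbhs_pinfty_ge; rewrite num_real.
have T0 : 0 < t^-1 `^ (m / 2) by rewrite powR_gt0// invr_gt0.
have w0 : 0 < omega by exact: lt_le_trans wT.
rewrite /delta_omega powRN -[leRHS]invrK lef_pV2 ?posrE ?invr_gt0 ?powR_gt0//.
have -> : t^-1 = (t^-1 `^ (m / 2)) `^ (2 / m).
  rewrite -powRrM; have -> : m / 2 * (2 / m) = 1 by field; rewrite gt_eqF.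
  by rewrite powRr1// invr_ge0 ltW.
apply: ge0_ler_powR; rewrite ?nnegrE ?(ltW T0) ?(ltW w0)//.
by rewrite divr_ge0// ltW.
Unshelve. all: by end_near. Qed.

Theorem lemma8 (R : realType) (m k CPhi : R) (Phi : R -> R) (Y : R -> R)
    (hPhi : potential m k CPhi Phi) (hY : is_Ybar m Y) :
  (\forall omega \near pinfty_nbhs R, forall xi : R, is_xi m Y omega xi ->
    [/\ forall x, Vbreve m Y omega xi (- x) = Vbreve m Y omega xi x,
        forall x, Rbreve m Y omega xi x =
          - omega^-1 * convolution (chi_omega xi)
            (fun y => delta_omega m omega * beta_omega m omega xi * Vbreve m Y omega xi y) x,
        forall x, 0 <= x <= 2 * xi ->
          Vbreve m Y omega xi x =
            - (1 / 2) * omega * alpha_omega m omega xi `^ (- (m / 2))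
              * (derive1 Y (x - xi) - derive1 Y xi) &
        forall x, 2 * xi <= x -> Vbreve m Y omega xi x = 0]) /\
  (forall D : R, exists C : R, \forall omega \near pinfty_nbhs R,
    forall (xi : R) (Rt : R -> R),
      is_xi m Y omega xi ->
      is_distance_profile m k Phi Y D omega xi Rt ->
      let Vt := Vtilde m Phi omega xi Rt in
      let Vb := Vbreve m Y omega xi in
      let dV := fun x => omega^-1 * Vt x - omega^-1 * Vb x in
      let dV' := fun x => omega^-1 * derive1 Vt x - omega^-1 * derive1 Vb x in
      ((delta_omega m omega)%:E * Lpnorm 1 dV + Lpnorm +oo dV + Lpnorm 1 dV'
       <= (C * delta_omega m omega `^ (Num.min k m))%:E)%E).
Proof.
have m0 : 0 < m by case: hPhi.
split.
  near=> omega => xi hxi.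
  have w0 : 0 < omega by near: omega; apply: nbhs_pinfty_gt; rewrite num_real.
  split=> x.
  - exact: (Vbreve_even m0 hY w0 hxi).
  - exact: (Rbreve_Vbreve m0 hY w0 hxi).
  - exact: (Vbreve_inside m0 hY w0 hxi).
  - exact: (Vbreve_outside m0 hY w0 hxi).
move=> D.
have [s s0 [a a0 xi_le]] := xi_bounds m0 hY.
have [theta theta1 slope] := xi_slope_bound m0 hY.
(* The first entry gives [theta <= 1 - 2 * e], half of the gap being left for the error [W]; the cap
   1 places [- 1 + e] in the domain of the force. *)
pose e := Num.min ((1 - theta) / 2) 1.
have e0 : 0 < e by rewrite lt_min ltr01 andbT; lra.
have e1 : 0 < e <= 1 by rewrite e0 ge_min lexx orbT.
have e2 : e <= (1 - theta) / 2 by rewrite ge_min lexx.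
have [K K0 linear] := dPhi1_linear_bound hPhi e1.
pose A := a `^ (m + 2) * K * (6 * s + `|D|).
pose H := `|D| / 2 + 2 * A.
have A0 : 0 <= A by rewrite !mulr_ge0 ?powR_ge0 ?(ltW K0)// addr_ge0// mulr_ge0// ltW.
have H0 : 0 <= H by rewrite addr_ge0 ?divr_ge0// mulr_ge0.
exists ((4 * s ^+ 2 + 6 * s) * H).
near=> omega => xi Rt hxi [Rt10 _ RtE star] /=.
have w1 : 1 <= omega by near: omega; apply: nbhs_pinfty_ge; rewrite num_real.
have w0 : 0 < omega by lra.
have d0 := delta_omega_gt0 m w0.
have d1 := delta_omega_le1 m0 w1.
have a_gt0 := alpha_omega_gt0 w0 hxi.
have [ds alpha_le] := xi_le _ _ w0 hxi.
have xi1 := is_xi_ge1 hxi.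
have dsmall : delta_omega m omega <= e / (`|D| + 1).
  by near: omega; apply: delta_omega_small => //; rewrite divr_gt0// ltr_wpDl.
have min1 : 1 < Num.min k m by case: hPhi.
have minm : Num.min k m <= m by rewrite ge_min lexx orbT.
have {slope} slope : delta_omega m omega * alpha_omega m omega xi * xi * derive1 Y xi
    <= 1 - 2 * e by have := slope _ _ w0 hxi; lra.
move: (Num.min k m) min1 minm star => p p1 pm star.
set d := delta_omega m omega in d0 d1 ds dsmall slope star *.
set al := alpha_omega m omega xi in a_gt0 alpha_le slope.
have d_ne0 : (d == 0) = false by rewrite gt_eqF.
have dpD q r : d `^ (q + r) = d `^ q * d `^ r.
  by rewrite powRD// d_ne0 implybT.
have dp1 : d `^ 1 = d by rewrite powRr1// ltW.
have dp q r : q <= r -> d `^ r <= d `^ q.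
  by move=> qr; apply: ger_powR => //; rewrite d0.
have dp_gt0 q : 0 < d `^ q by exact: powR_gt0.
have dple1 q : 0 <= q -> d `^ q <= 1 by move=> /dp; rewrite powRr0.
(* As [p > 1] and [d <= 1], the quotient is at most [|D| * d], which [dsmall] makes smaller than
   [e]. *)
have Bd : D * d `^ (p + 1) / d <= e.
  rewrite dpD dp1 mulrA mulfK ?d_ne0//.
  apply: (@le_trans _ _ (`|D| * d)).
    apply: (@le_trans _ _ (`|D| * d `^ p)); first by rewrite ler_wpM2r ?ler_norm// ltW.
    by rewrite ler_wpM2l// -[leRHS]dp1 dp// ltW.
  move: dsmall; rewrite ler_pdivlMr ?ltr_wpDl// mulrDr mulr1 mulrC.
  by move: d0; lra.
have := discrepancy_norm1_le hPhi hY w0 hxi Rt10 RtE K0 e0 linear slope Bd star.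
rewrite -/d -/al => hn.
(* Here [p > 1] leaves the nonnegative power [p - 1] of [d <= 1], so the L1 norm of [W] stays
   bounded. *)
have Bd2 : D * d `^ (p + 1) / d ^+ 2 <= `|D|.
  have -> : p + 1 = (p - 1) + 1 + 1 by ring.
  rewrite (dpD (p - 1 + 1)) (dpD (p - 1)) dp1 expr2 invfM.
  have -> : D * (d `^ (p - 1) * d * d) * (d^-1 * d^-1) = D * d `^ (p - 1).
    by field; rewrite gt_eqF.
  apply: le_trans (ler_norm _) _; rewrite normrM (ger0_norm (ltW (dp_gt0 _))).
  by rewrite ler_piMr// dple1//; lra.
have hN : (\int[@lebesgue_measure R]_x `|discrepancy m Phi Y omega xi Rt x|%:E
    <= (H * d `^ (p + 1))%:E)%E.
  rewrite -(@lee_pmul2l _ 2%:E)//.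
  apply: le_trans hn _; rewrite -EFinM lee_fin.
  have -> : 2 * (H * d `^ (p + 1)) = `|D| * d `^ (p + 1) + 4 * (A * d `^ (p + 1)).
    by rewrite /H; field.
  apply: lerD; first by rewrite ler_wpM2r ?ler_norm// ltW.
  rewrite ler_pM2l//.
  apply: (@le_trans _ _ (d `^ (m + 2) * a `^ (m + 2) * K * (6 * xi + `|D|))).
    apply: (@le_trans _ _ (d `^ (m + 2) * al `^ (m + 2) * K * (6 * xi + `|D|))).
      by apply: ler_wpM2l; [rewrite !mulr_ge0 ?powR_ge0 ?(ltW K0)|rewrite lerD2l].
    apply: ler_wpM2r; first by rewrite addr_ge0// mulr_ge0//; lra.
    rewrite ler_pM2r// ler_pM2l//.
    by apply: ge0_ler_powR; rewrite ?nnegrE ?(ltW a_gt0) ?(ltW a0)//; lra.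
  (* One factor [d] compensates [xi] through [d * xi <= s]; the remaining [d]^ (m + 1)[is at most]d
     [^ (p + 1)] because [p <= m]. *)
  have -> : m + 2 = m + 1 + 1 by ring.
  rewrite dpD dp1.
  have -> : d `^ (m + 1) * d * a `^ (m + 1 + 1) * K * (6 * xi + `|D|) =
    (a `^ (m + 1 + 1) * K * (6 * (d * xi) + d * `|D|)) * d `^ (m + 1) by ring.
  apply: ler_pM.
  - rewrite !mulr_ge0 ?powR_ge0 ?(ltW K0)// addr_ge0//.
      by rewrite !mulr_ge0 ?(ltW d0)//; lra.
    by rewrite mulr_ge0// ltW.
  - exact: ltW.
  - rewrite /A; have -> : m + 2 = m + 1 + 1 by ring.
    apply: ler_wpM2l; first by rewrite mulr_ge0 ?powR_ge0// ltW.
    by apply: lerD; [rewrite ler_pM2l|rewrite ler_piMl].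
  - by apply: dp; lra.
apply: le_trans (velocity_difference_norms_le hPhi hY w0 hxi Rt10 RtE hN) _.
rewrite -/d lee_fin dpD dp1.
have -> : d * (2 * xi * (2 * xi * (H * (d `^ p * d)))) + 2 * xi * (H * (d `^ p * d)) +
   2 * xi * (H * (d `^ p * d) + H * (d `^ p * d)) =
  (4 * (d * xi) ^+ 2 + 6 * (d * xi)) * H * d `^ p by ring.
rewrite ler_pM2r//; apply: ler_wpM2r => //.
have dx0 : 0 <= d * xi by rewrite mulr_ge0 ?(ltW d0)//; lra.
apply: lerD; last by rewrite ler_pM2l.
by rewrite ler_pM2l// lerXn2r// ?nnegrE// ltW.
Unshelve. all: by end_near. Qed.
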